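(* For each choice of quantifier $\mathbb{Q}\in\{\forall,\exists\}$, trajectory modality $\mathsf{M}\in\{\mathsf{E},\mathsf{A}\}$, and class $\mathcal{C}\in\{\text{admissible},\text{co-admissible}\}$, the following problem is decidable: given a finite Kripke structure $\mathcal{K}$ and an A-HLTL formula $\mathbb{Q}\pi_1\ldots\mathbb{Q}\pi_n.\,\mathsf{M}.\,\psi$ with $\psi$ a formula over $\pi_1,\ldots,\pi_n$ in class $\mathcal{C}$, decide whether $\mathcal{K}\models\mathbb{Q}\pi_1\ldots\mathbb{Q}\pi_n.\,\mathsf{M}.\,\psi$.
   Context: Let $\mathsf{AP}$ be a finite set of atomic propositions and $\Sigma=2^{\mathsf{AP}}$; traces are elements of $\Sigma^\omega$. A Kripke structure is $\mathcal{K}=\langle S,S_{\mathit{init}},\delta,L\rangle$ with initial states $S_{\mathit{init}}\subseteq S$, transition relation $\delta\subseteq S\times S$ where every state has a successor, and labeling $L:S\to\Sigma$; $\mathsf{Traces}(\mathcal{K})$ is the set of label sequences of paths starting in $S_{\mathit{init}}$. Two traces $\sigma,\sigma'$ are stuttering equivalent if there are index sequences $0=i_0<i_1<\cdots$, $0=j_0<j_1<\cdots$ with $\sigma(l)=\sigma'(l')$ for all $k$, $l\in[i_k,i_{k+1})$, $l'\in[j_k,j_{k+1})$. A-HLTL syntax: $\varphi::=\exists\pi.\varphi\mid\forall\pi.\varphi\mid\mathsf{E}\psi\mid\mathsf{A}\psi$, $\psi::=a_\pi\mid\neg\psi\mid\psi\vee\psi\mid\psi\,\mathcal{U}\,\psi\mid\bigcirc\psi$,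 with the usual abbreviations ($\wedge,\to,\leftrightarrow,\Diamond\psi=\mathit{true}\,\mathcal{U}\,\psi,\Box\psi=\neg\Diamond\neg\psi$). Semantics: trace assignments $\Pi$ map trace variables to pointed traces $(\sigma,p)$. A trajectory over $V$ is an infinite sequence $t$ of nonempty subsets of $V$, fair if each $\pi\in V$ lies in infinitely many $t(j)$. $(\Pi,t)+1=(\Pi',t(1)t(2)\cdots)$, where $\Pi'$ advances the pointers of the variables in $t(0)$ by one and keeps the others; $(\Pi,t)+k$ iterates. Quantifiers bind $\pi$ to $(\sigma,0)$ for some/all $\sigma\in\mathsf{Traces}(\mathcal{K})$; $\Pi\models\mathsf{E}\psi$ (resp. $\mathsf{A}\psi$) iff $(\Pi,t)\models\psi$ for some (resp. all) fair trajectories $t$ over $\mathrm{Dom}(\Pi)$; $(\Pi,t)\models a_\pi$ iff $a\in\sigma(p)$ where $\Pi(\pi)=(\sigma,p)$; Booleans as usual; $(\Pi,t)\models\bigcirc\psi$ iff $(\Pi,t)+1\models\psi$; $(\Pi,t)\models\psi_1\mathcal{U}\psi_2$ iff for some $i\ge0$, $(\Pi,t)+i\models\psi_2$ and $(\Pi,t)+j\models\psi_1$ for all $j<i$. $\mathcal{K}\models\varphi$ iff the empty assignment satisfies $\varphi$. A state formula is a Boolean combination of atoms $a_\pi$ (no temporal operators). A monadic temporal formula is a $\psi$-formula whose atoms mention only one trace variable and whose LTL truth value is invariant under stuttering equivalence. An atomic phase formula is $\bigwedge_{p\in P}(p_{\pi_i}\leftrightarrow p_{\pi_j})$ with $P\subseteq\mathsf{AP}$,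 $\pi_i\neq\pi_j$. A phase formula is $\Box R$ and a co-phase formula is $\Diamond\neg R$, where $R$ is a conjunction of atomic phase formulas. An admissible formula is a Boolean combination of state formulas, monadic temporal formulas and exactly one occurrence of a phase formula (in either polarity). A co-admissible formula is a Boolean combination of state formulas, monadic temporal formulas and exactly one occurrence of a co-phase formula, that occurrence being in positive polarity (under an even number of negations). *)

(* Defs.v *)
From mathcomp Require Import all_boot.

Set Implicit Arguments.
Unset Strict Implicit.
Unset Printing Implicit Defensive.

(** * Decidability *)

(* The total recursive functions on tuples of naturals (Kleene), as the least
   class of functions containing zero, successor and projections and closed
   under composition, primitive recursion and regular minimization.  Everything
   except the base functions is specified by its defining equations. *)
Inductive recursive : forall n, (n.-tuple nat -> nat) -> Prop :=
| Rec_zero n : recursive (fun _ : n.-tuple nat => 0)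
| Rec_succ : recursive (fun v : 1.-tuple nat => (thead v).+1)
| Rec_proj n (i : 'I_n) : recursive (fun v : n.-tuple nat => tnth v i)
| Rec_comp m n (f : m.-tuple nat -> nat) (g : 'I_m -> n.-tuple nat -> nat)
    (h : n.-tuple nat -> nat) :
    recursive f -> (forall i, recursive (g i)) ->
    (forall v, h v = f [tuple g i v | i < m]) ->
    recursive h
| Rec_prim n (f : n.-tuple nat -> nat) (g : n.+2.-tuple nat -> nat)
    (h : n.+1.-tuple nat -> nat) :
    recursive f -> recursive g ->
    (forall v : n.-tuple nat, h [tuple of 0 :: v] = f v) ->
    (forall (v : n.-tuple nat) k,
       h [tuple of k.+1 :: v]
       = g [tuple of k :: h [tuple of k :: v] :: v]) ->
    recursive h
| Rec_min n (f : n.+1.-tuple nat -> nat) (h : n.-tuple nat -> nat) :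
    recursive f ->
    (forall v : n.-tuple nat, f [tuple of h v :: v] = 0) ->
    (forall (v : n.-tuple nat) k, k < h v -> f [tuple of k :: v] <> 0) ->
    recursive h.

(* The problem "given i satisfying [inst], decide whether [yes i]", with i
   presented to the algorithm as the number [code i].  Nothing is required of
   the answer on numbers that do not code an instance. *)
Definition decidable_problem (I : Type) (code : I -> nat)
    (inst yes : I -> Prop) : Prop :=
  exists2 f : 1.-tuple nat -> nat, recursive f &
    forall i, inst i -> (yes i <-> f [tuple code i] = 1).

(** * Kripke structures, traces, stuttering *)

Definition trace (AP : finType) := nat -> {set AP}.

Record kripke (AP : finType) := Kripke {
  state : finType;
  init : {set state};
  trans : rel state;
  label : state -> {set AP};
  trans_total : forall s, exists s', trans s s'
}.

Definition is_trace (AP : finType) (K : kripke AP) (sigma : trace AP) : Prop :=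
  exists rho : nat -> state K,
    [/\ rho 0 \in init K,
        forall i, trans (rho i) (rho i.+1) &
        forall i, sigma i = label (rho i)].

Definition stutter_equiv (AP : finType) (sigma sigma' : trace AP) : Prop :=
  exists i j : nat -> nat,
    [/\ i 0 = 0, j 0 = 0,
        forall k, i k < i k.+1,
        forall k, j k < j k.+1 &
        forall k l l', i k <= l < i k.+1 -> j k <= l' < j k.+1 ->
          sigma l = sigma' l'].

(** * Syntax of A-HLTL *)

Definition var := nat.

(* [PTrue] is primitive, so that [true] also makes sense when no atom is
   available. *)
Inductive pformula (AP : finType) : Type :=
| PTrue
| PAtom (a : AP) (x : var)
| PNot (f : pformula AP)
| POr (f g : pformula AP)
| PUntil (f g : pformula AP)
| PNext (f : pformula AP).
Arguments PTrue {AP}.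

Section Abbreviations.
Variable AP : finType.
Implicit Types f g : pformula AP.

Definition PAnd f g := PNot (POr (PNot f) (PNot g)).
Definition PImpl f g := POr (PNot f) g.
Definition PIff f g := PAnd (PImpl f g) (PImpl g f).
Definition PDiamond f := PUntil PTrue f.
Definition PBox f := PNot (PDiamond (PNot f)).

Fixpoint pvars f : seq var :=
  match f with
  | PTrue => [::]
  | PAtom _ x => [:: x]
  | PNot f | PNext f => pvars f
  | POr f g | PUntil f g => pvars f ++ pvars g
  end.

End Abbreviations.

Inductive quantifier := Forall | Exists.
Inductive modality := ModE | ModA.

Inductive formula (AP : finType) : Type :=
| Quant (Q : quantifier) (x : var) (phi : formula AP)
| Traj (M : modality) (psi : pformula AP).

Definition prefixed (AP : finType) (Q : quantifier) (xs : seq var)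
    (M : modality) (psi : pformula AP) : formula AP :=
  foldr (Quant Q) (Traj M psi) xs.

(** * Semantics of A-HLTL *)

Definition assignment (AP : finType) := var -> option (trace AP * nat).

Definition empty_assignment {AP : finType} : assignment AP := fun=> None.

Definition update (AP : finType) (Pi : assignment AP) (x : var)
    (st : trace AP * nat) : assignment AP :=
  fun y => if y == x then Some st else Pi y.

Definition dom (AP : finType) (Pi : assignment AP) : pred var :=
  fun x => isSome (Pi x).

Definition trajectory := nat -> pred var.

Definition trajectory_over (V : pred var) (t : trajectory) : Prop :=
  forall j, (exists x, t j x) /\ (forall x, t j x -> V x).

Definition fair (V : pred var) (t : trajectory) : Prop :=
  forall x, V x -> forall i, exists2 j, i <= j & t j x.

Definition succ (AP : finType) (c : assignment AP * trajectory)
    : assignment AP * trajectory :=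
  (fun x => if c.1 x is Some (sigma, p)
            then Some (sigma, if c.2 0 x then p.+1 else p)
            else None,
   fun j => c.2 j.+1).

Fixpoint psat (AP : finType) (c : assignment AP * trajectory)
    (psi : pformula AP) : Prop :=
  match psi with
  | PTrue => True
  | PAtom a x => if c.1 x is Some (sigma, p) then a \in sigma p else False
  | PNot f => ~ psat c f
  | POr f g => psat c f \/ psat c g
  | PUntil f g =>
      exists i, psat (iter i (@succ AP) c) g /\
        forall j, j < i -> psat (iter j (@succ AP) c) f
  | PNext f => psat (succ c) f
  end.

Fixpoint sat (AP : finType) (K : kripke AP) (Pi : assignment AP)
    (phi : formula AP) : Prop :=
  match phi with
  | Quant Exists x f =>
      exists sigma, is_trace K sigma /\ sat K (update Pi x (sigma, 0)) f
  | Quant Forall x f =>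
      forall sigma, is_trace K sigma -> sat K (update Pi x (sigma, 0)) f
  | Traj ModE psi =>
      exists t, [/\ trajectory_over (dom Pi) t, fair (dom Pi) t &
                    psat (Pi, t) psi]
  | Traj ModA psi =>
      forall t, trajectory_over (dom Pi) t -> fair (dom Pi) t ->
        psat (Pi, t) psi
  end.

Definition models (AP : finType) (K : kripke AP) (phi : formula AP) : Prop :=
  sat K empty_assignment phi.

(** * Admissible and co-admissible formulas *)

(* LTL semantics at position p of a single trace; trace variables are ignored,
   and it is only used on formulas mentioning at most one of them. *)
Fixpoint ltl (AP : finType) (sigma : trace AP) (p : nat)
    (psi : pformula AP) : Prop :=
  match psi with
  | PTrue => True
  | PAtom a _ => a \in sigma p
  | PNot f => ~ ltl sigma p f
  | POr f g => ltl sigma p f \/ ltl sigma p g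
  | PUntil f g =>
      exists i, ltl sigma (p + i) g /\ forall j, j < i -> ltl sigma (p + j) f
  | PNext f => ltl sigma p.+1 f
  end.

Section Classes.
Variable AP : finType.
Implicit Types f g : pformula AP.

Fixpoint state_formula f : Prop :=
  match f with
  | PTrue | PAtom _ _ => True
  | PNot f => state_formula f
  | POr f g => state_formula f /\ state_formula g
  | PUntil _ _ | PNext _ => False
  end.

Definition monadic_formula f : Prop :=
  (exists x, {subset pvars f <= [:: x]}) /\
  (forall sigma sigma' : trace AP, stutter_equiv sigma sigma' ->
     (ltl sigma 0 f <-> ltl sigma' 0 f)).

(* Finite conjunctions, up to bracketing; the empty one is [PTrue]. *)
Inductive conj_of (X : pformula AP -> Prop) : pformula AP -> Prop :=
| Conj_empty : conj_of X PTrue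
| Conj_one f : X f -> conj_of X f
| Conj_and f g : conj_of X f -> conj_of X g -> conj_of X (PAnd f g).

Definition atomic_phase f : Prop :=
  exists x y : var, x <> y /\
    conj_of (fun g => exists a : AP, g = PIff (PAtom a x) (PAtom a y)) f.

Definition phase f : Prop :=
  exists2 R, conj_of atomic_phase R & f = PBox R.

Definition co_phase f : Prop :=
  exists2 R, conj_of atomic_phase R & f = PDiamond (PNot R).

(* [bool_comb X k b f]: f is a Boolean combination of state formulas, monadic
   formulas and exactly k occurrences of formulas from X, where [X c] is the
   set allowed at polarity c (true = positive) and b is the polarity of f
   itself. *)
Inductive bool_comb (X : bool -> pformula AP -> Prop)
    : nat -> bool -> pformula AP -> Prop :=
| BC_state b f : state_formula f -> bool_comb X 0 b f
| BC_monadic b f : monadic_formula f -> bool_comb X 0 b f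
| BC_special b f : X b f -> bool_comb X 1 b f
| BC_not k b f : bool_comb X k (~~ b) f -> bool_comb X k b (PNot f)
| BC_or k l b f g :
    bool_comb X k b f -> bool_comb X l b g -> bool_comb X (k + l) b (POr f g).

Definition admissible f : Prop := bool_comb (fun _ => phase) 1 true f.

Definition co_admissible f : Prop :=
  bool_comb (fun b g => b /\ co_phase g) 1 true f.

End Classes.

Inductive formula_class := Admissible | CoAdmissible.

Definition in_class (AP : finType) (C : formula_class) (f : pformula AP)
    : Prop :=
  match C with
  | Admissible => admissible f
  | CoAdmissible => co_admissible f
  end.

(** * Model-checking instances *)

(* Finite objects are presented as numbers through the effective bijection
   [CodeSeq.code : seq nat -> nat]; elements of a finite type are numbered by
   [enum_rank]. *)
Section Encoding.
Variable AP : finType.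

Definition code_elt (T : finType) (x : T) : nat := enum_rank x.

Definition code_set (T : finType) (A : pred T) : nat :=
  CodeSeq.code [seq code_elt x | x <- enum A].

(* A state is listed as: initial or not, successors, labels. *)
Definition code_kripke (K : kripke AP) : nat :=
  CodeSeq.code
    [seq CodeSeq.code [:: nat_of_bool (s \in init K);
                          code_set (trans s);
                          code_set (mem (label s))]
    | s <- enum (state K)].

Fixpoint code_pformula (f : pformula AP) : nat :=
  match f with
  | PTrue => CodeSeq.code [:: 0]
  | PAtom a x => CodeSeq.code [:: 1; code_elt a; x]
  | PNot f => CodeSeq.code [:: 2; code_pformula f]
  | POr f g => CodeSeq.code [:: 3; code_pformula f; code_pformula g]
  | PUntil f g => CodeSeq.code [:: 4; code_pformula f; code_pformula g]
  | PNext f => CodeSeq.code [:: 5; code_pformula f]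
  end.

Fixpoint code_formula (phi : formula AP) : nat :=
  match phi with
  | Quant Forall x f => CodeSeq.code [:: 0; x; code_formula f]
  | Quant Exists x f => CodeSeq.code [:: 1; x; code_formula f]
  | Traj ModE psi => CodeSeq.code [:: 2; code_pformula psi]
  | Traj ModA psi => CodeSeq.code [:: 3; code_pformula psi]
  end.

Definition code_instance (i : kripke AP * formula AP) : nat :=
  CodeSeq.code [:: code_kripke i.1; code_formula i.2].

End Encoding.

Definition mc_instance (AP : finType) (Q : quantifier) (M : modality)
    (C : formula_class) (i : kripke AP * formula AP) : Prop :=
  exists (xs : seq var) (psi : pformula AP),
    [/\ uniq xs, {subset pvars psi <= xs}, in_class C psi &
        i.2 = prefixed Q xs M psi].

(* Main.v *)
(* Universal trajectory quantification is eliminated as follows.  All conjuncts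
   of the matrix but the phase formula [\Box R] have a truth value that does
   not depend on the trajectory, so [A psi] reduces to the three conditions
   "psi holds for both values of [\Box R]", "every trajectory satisfies
   [\Box R]" and "no trajectory satisfies [\Box R]".  The second one only says
   that every [a_x <-> a_y] in [R] compares constant propositions.  The third
   one has a finite witness: along any prefix satisfying [R] the k-th change of
   [a] in [x] coincides with the k-th change of [a] in [y], so that alignment
   fails exactly if some such prefix leads to a deadlock, i.e. a set [C] of
   traces each nonempty part of which is prevented from moving first by the
   other traces of [C] or by propositions that never change again.  Deadlocks
   are visible to a path formula, hence [exists pi. A psi] becomes
   [exists pi. E psi'].  The latter asks for a fair path in the product of
   copies of the Kripke structure, which a tableau reduces to a certificate of
   bounded size: a set [W] of nodes such that, from each node of [W], every
   fairness condition is reachable inside [W].  Nodes and sets being bit masks,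
   this is a formula with bounded quantifiers. *)

Require Import Defs.
From mathcomp Require Import all_boot.
From mathcomp Require Import boolp.

Set Implicit Arguments.
Unset Strict Implicit.
Unset Printing Implicit Defensive.

Import CodeSeq.

(** * Recursive functions of an environment *)

(** The hard case is [exists pi. A psi]: one choice of traces must serve all trajectories, whose
    pointers drift apart without bound. The restriction to the two classes serves to remove this
    alternation; [exists pi. E psi] is LTL over the word spelled by the traces and the trajectory,
    and is decided for every [psi]. Outer universal quantifiers become existential ones by negating
    the body, so both classes are relaxed to one that is closed under negation. A deadlock met along
    one prefix condemns every trajectory, not only the extensions of that prefix: the first passage
    beyond it would unbalance the numbers of changes, and these depend on positions, not on the
    route to them. Conversely, a reachable configuration with as many frozen traces as possible is a
    deadlock of its frozen traces; if none is frozen, serving the traces in turn gives a fair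
    aligned trajectory. The same round-robin argument, on another graph, shows that certificates are
    sound. Correctness is proved classically, but the procedure is an explicit function built from
    the clauses of [recursive], so its computability does not rest on classical choice. *)

(* An environment lists the values of the free variables, innermost first: a
   binder over [k] turns the environment [e] into [k :: e]. *)
Definition rec (f : seq nat -> nat) : Prop :=
  forall n, recursive (fun v : n.-tuple nat => f v).

Lemma rec_ext f g : f =1 g -> rec f -> rec g.
Proof. by move=> /funext->. Qed.

Lemma rec_subst F (fs : seq (seq nat -> nat)) :
  rec F -> (forall i, i < size fs -> rec (nth (fun=> 0) fs i)) ->
  rec (fun e => F [seq f e | f <- fs]).
Proof.
move=> rF rfs n.
apply: (Rec_comp (rF (size fs)) (g := fun i v => nth (fun=> 0) fs i v)).
  by move=> i; apply: rfs.
move=> v; congr F; apply: (@eq_from_nth _ 0).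
  by rewrite size_map size_tuple.
move=> i; rewrite size_map => lti.
rewrite (nth_map (fun=> 0)) // -[i in RHS]/(val (Ordinal lti)) -tnth_nth.
by rewrite tnth_mktuple.
Qed.

Lemma recursive_const n k : recursive (fun _ : n.-tuple nat => k).
Proof.
elim: k => [|k IHk]; first exact: Rec_zero.
by apply: (Rec_comp Rec_succ (g := fun=> fun=> k)) => // v; rewrite /thead tnth_mktuple.
Qed.

Lemma rec_const k : rec (fun=> k).
Proof. by move=> n; apply: recursive_const. Qed.

Lemma rec_nth i : rec (fun e => nth 0 e i).
Proof.
move=> n; have [lti|leni] := ltnP i n.
  rewrite (_ : (fun _ => _) = (fun v : n.-tuple nat => tnth v (Ordinal lti))).
    exact: Rec_proj.
  by apply/funext=> v; rewrite (tnth_nth 0).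
rewrite (_ : (fun _ => _) = (fun=> 0)); first exact: Rec_zero.
by apply/funext=> v; rewrite nth_default ?size_tuple.
Qed.

Lemma rec_succ f : rec f -> rec (fun e => (f e).+1).
Proof.
move=> rf n; apply: (Rec_comp Rec_succ (g := fun=> f)) => [_|v]; first exact: rf.
by rewrite /thead tnth_mktuple.
Qed.

(* The arity is split since [behead] is the identity on the empty environment. *)
Lemma rec_weak f : rec f -> rec (fun e => f (behead e)).
Proof.
move=> rf [|n].
  have ->: (fun v : 0.-tuple nat => f (behead v)) = (fun v => f v).
    by apply/funext=> v; rewrite tuple0.
  exact: rf.
apply: (Rec_comp (rf n) (g := fun i v => nth 0 v i.+1)) => [i|v].
  exact: rec_nth.
congr f; apply: (@eq_from_nth _ 0); rewrite size_behead !size_tuple // => i lti.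
by rewrite nth_behead -[i in RHS]/(val (Ordinal lti)) -tnth_nth tnth_mktuple.
Qed.

Lemma rec_push F f : rec F -> rec f -> rec (fun e => F (f e :: e)).
Proof.
move=> rF rf n.
apply: (Rec_comp (rF n.+1)
  (g := fun i v => nth 0 (f v :: v) i)) => [[[|i] lti]|v].
- exact: rf.
- exact: rec_nth.
congr F; apply: (@eq_from_nth _ 0) => [|i lti].
  by rewrite [RHS]size_tuple /= size_tuple.
have {}lti : i < n.+1 by move: lti; rewrite /= size_tuple.
by rewrite -[i in RHS]/(val (Ordinal lti)) -tnth_nth tnth_mktuple.
Qed.

Lemma rec_iteri (a f : seq nat -> nat) (G : nat -> nat -> seq nat -> nat) :
  rec (fun e => G (head 0 e) (head 0 (behead e)) (behead (behead e))) ->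
  rec a -> rec f ->
  rec (fun e => iteri (a e) (fun k r => G k r e) (f e)).
Proof.
move=> rG ra rf.
pose F e := iteri (head 0 e) (fun k r => G k r (behead e)) (f (behead e)).
suff rF: rec F by apply: (rec_push rF ra).
(* In the empty environment the count is the default [0], so no round is run. *)
case=> [|n].
  have ->: (fun v : 0.-tuple nat => F v) = (fun v => f v).
    by apply/funext=> v; rewrite tuple0.
  exact: rf.
exact: (Rec_prim (rf n) (rG n.+2)).
Qed.

Lemma rec_iter (a f : seq nat -> nat) (G : nat -> seq nat -> nat) :
  rec (fun e => G (head 0 e) (behead e)) -> rec a -> rec f ->
  rec (fun e => iter (a e) (fun r => G r e) (f e)).
Proof.
move=> rG ra rf.
have /= := @rec_iteri a f (fun _ r e => G r e) _ ra rf.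
move=> /(_ (rec_weak rG)); apply: rec_ext => e.
by elim: (a e) => //= n ->.
Qed.

Lemma rec_app1 (g : nat -> nat) f :
  rec (fun e => g (head 0 e)) -> rec f -> rec (fun e => g (f e)).
Proof. exact: rec_push. Qed.

Lemma rec_app2 (g : nat -> nat -> nat) f1 f2 :
  rec (fun e => g (head 0 e) (head 0 (behead e))) ->
  rec f1 -> rec f2 -> rec (fun e => g (f1 e) (f2 e)).
Proof.
move=> rg r1 r2.
by apply: (@rec_subst _ [:: f1; f2]) rg _ => -[|[|]].
Qed.

Lemma rec_app3 (g : nat -> nat -> nat -> nat) f1 f2 f3 :
  rec (fun e => g (head 0 e) (head 0 (behead e)) (head 0 (behead (behead e)))) ->
  rec f1 -> rec f2 -> rec f3 -> rec (fun e => g (f1 e) (f2 e) (f3 e)).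
Proof.
move=> rg r1 r2 r3.
by apply: (@rec_subst _ [:: f1; f2; f3]) rg _ => -[|[|[|]]].
Qed.

Lemma rec_app4 (g : nat -> nat -> nat -> nat -> nat) f1 f2 f3 f4 :
  rec (fun e => g (head 0 e) (head 0 (behead e)) (head 0 (behead (behead e)))
                  (head 0 (behead (behead (behead e))))) ->
  rec f1 -> rec f2 -> rec f3 -> rec f4 ->
  rec (fun e => g (f1 e) (f2 e) (f3 e) (f4 e)).
Proof.
move=> rg r1 r2 r3 r4.
by apply: (@rec_subst _ [:: f1; f2; f3; f4]) rg _ => -[|[|[|[|]]]].
Qed.

Lemma rec_app5 (g : nat -> nat -> nat -> nat -> nat -> nat) f1 f2 f3 f4 f5 :
  rec (fun e => g (head 0 e) (head 0 (behead e)) (head 0 (behead (behead e)))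
                  (head 0 (behead (behead (behead e))))
                  (head 0 (behead (behead (behead (behead e)))))) ->
  rec f1 -> rec f2 -> rec f3 -> rec f4 -> rec f5 ->
  rec (fun e => g (f1 e) (f2 e) (f3 e) (f4 e) (f5 e)).
Proof.
move=> rg r1 r2 r3 r4 r5.
by apply: (@rec_subst _ [:: f1; f2; f3; f4; f5]) rg _ => -[|[|[|[|[|]]]]].
Qed.

Lemma rec_var k : rec (fun e => head 0 (iter k behead e)).
Proof.
elim: k => [|k IHk]; first by apply: rec_ext (rec_nth 0) => e; rewrite nth0.
by apply: rec_ext (rec_weak IHk) => e; rewrite iterSr.
Qed.

(** A Boolean is an iteration count of 0 or 1: a single round overwrites [g e] by [f e]. *)
Lemma rec_ite (b : seq nat -> bool) f g :
  rec (fun e => b e) -> rec f -> rec g ->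
  rec (fun e => if b e then f e else g e).
Proof.
move=> rb rf rg.
have := @rec_iteri (fun e => b e) g (fun _ _ e => f e).
move=> /(_ (rec_weak (rec_weak rf)) rb rg); apply: rec_ext => e.
by case: (b e).
Qed.

Lemma rec_neg (b : seq nat -> bool) :
  rec (fun e => b e) -> rec (fun e => ~~ b e).
Proof.
move=> rb; apply: rec_ext (rec_ite rb (rec_const 0) (rec_const 1)) => e.
by case: (b e).
Qed.

Lemma rec_and (b c : seq nat -> bool) :
  rec (fun e => b e) -> rec (fun e => c e) -> rec (fun e => b e && c e).
Proof.
move=> rb rc; apply: rec_ext (rec_ite rb rc (rec_const 0)) => e.
by case: (b e).
Qed.

Lemma rec_or (b c : seq nat -> bool) :
  rec (fun e => b e) -> rec (fun e => c e) -> rec (fun e => b e || c e).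
Proof.
move=> rb rc; apply: rec_ext (rec_ite rb (rec_const 1) rc) => e.
by case: (b e).
Qed.

Lemma rec_imp (b c : seq nat -> bool) :
  rec (fun e => b e) -> rec (fun e => c e) -> rec (fun e => b e ==> c e).
Proof.
move=> rb rc; apply: rec_ext (rec_ite rb rc (rec_const 1)) => e.
by case: (b e).
Qed.

Lemma rec_iteb (b c d : seq nat -> bool) :
  rec (fun e => b e) -> rec (fun e => c e) -> rec (fun e => d e) ->
  rec (fun e => if b e then c e else d e).
Proof.
move=> rb rc rd; apply: rec_ext (rec_ite rb rc rd) => e.
by case: (b e).
Qed.

(** * Arithmetic and bounded search *)

Lemma rec_add f g : rec f -> rec g -> rec (fun e => f e + g e).
Proof.
move=> rf rg.
apply: rec_ext (rec_iter (G := fun r _ => r.+1) (rec_succ (rec_var 0)) rf rg).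
by move=> e; elim: (f e) => //= n ->.
Qed.

Lemma rec_mul f g : rec f -> rec g -> rec (fun e => f e * g e).
Proof.
move=> rf rg.
apply: rec_ext (rec_iter (G := fun r e => g e + r)
  (rec_add (rec_weak rg) (rec_var 0)) rf (rec_const 0)).
by move=> e; elim: (f e) => //= n ->; rewrite mulSn.
Qed.

Lemma rec_exp f g : rec f -> rec g -> rec (fun e => f e ^ g e).
Proof.
move=> rf rg.
apply: rec_ext (rec_iter (G := fun r e => f e * r)
  (rec_mul (rec_weak rf) (rec_var 0)) rg (rec_const 1)).
by move=> e; elim: (g e) => //= n ->; rewrite expnS.
Qed.

Lemma rec_pred f : rec f -> rec (fun e => (f e).-1).
Proof.
move=> rf.
apply: rec_ext (rec_iteri (G := fun k _ _ => k) (rec_var 0) rf (rec_const 0)).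
by move=> e; case: (f e).
Qed.

Lemma rec_sub f g : rec f -> rec g -> rec (fun e => f e - g e).
Proof.
move=> rf rg.
apply: rec_ext (rec_iter (G := fun r _ => r.-1) (rec_pred (rec_var 0)) rg rf).
by move=> e; elim: (g e) => [|n /= ->]; rewrite ?subn0 ?subnS.
Qed.

Lemma rec_leq f g : rec f -> rec g -> rec (fun e => f e <= g e).
Proof.
move=> rf rg.
apply: rec_ext (rec_sub (rec_const 1) (rec_sub rf rg)) => e.
by rewrite -subn_eq0; case: (f e - g e) => // n; rewrite subSS sub0n.
Qed.

Lemma rec_eq f g : rec f -> rec g -> rec (fun e => f e == g e).
Proof.
move=> rf rg; apply: rec_ext (rec_and (rec_leq rf rg) (rec_leq rg rf)) => e.
by rewrite -eqn_leq.
Qed.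

Lemma rec_eqb (b c : seq nat -> bool) :
  rec (fun e => b e) -> rec (fun e => c e) -> rec (fun e => b e == c e).
Proof.
move=> rb rc; apply: rec_ext (rec_eq rb rc) => e.
by case: (b e); case: (c e).
Qed.

(** In the loop rules the accumulator sits second in the environment; this lets a loop body ignore
    it. In arity 0 the environment is padded by the default head, in arity 1 nothing is dropped. *)
Lemma rec_skip1 F : rec F -> rec (fun e => F (head 0 e :: behead (behead e))).
Proof.
move=> rF [|[|n]].
- have ->: (fun v : 0.-tuple nat => F (head 0 v :: behead (behead v)))
         = (fun=> F [:: 0]) by apply/funext=> v; rewrite tuple0.
  exact: recursive_const.
- have ->: (fun v : 1.-tuple nat => F (head 0 v :: behead (behead v)))
         = (fun v => F v) by apply/funext=> v; case/tupleP: v => x v; rewrite tuple0.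
  exact: rF.
apply: (Rec_comp (rF n.+1)
  (g := fun i v => nth 0 (head 0 v :: behead (behead v)) i)) => [[[|i] lti]|v].
- exact: rec_var 0 _.
- exact: rec_weak (rec_weak (rec_nth i)) _.
congr F; apply: (@eq_from_nth _ 0) => [|i lti].
  by rewrite [RHS]size_tuple /= !size_behead size_tuple.
have {}lti : i < n.+1 by move: lti; rewrite /= !size_behead size_tuple.
by rewrite -[i in RHS]/(val (Ordinal lti)) -tnth_nth tnth_mktuple.
Qed.

Lemma rec_skip1' F f :
  rec F -> rec f -> rec (fun e => F (f e :: behead e)).
Proof.
move=> rF rf; exact: (rec_push (rec_skip1 rF) rf).
Qed.

Lemma iota0S n : iota 0 n.+1 = iota 0 n ++ [:: n].
Proof. by rewrite -addn1 iotaD. Qed.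

Lemma find_iotaE (P : pred nat) n i :
  i < n -> P i -> (forall j, j < i -> ~~ P j) -> find P (iota 0 n) = i.
Proof.
move=> ltin Pi minP.
have hasP: has P (iota 0 n) by apply/hasP; exists i; rewrite // mem_iota.
have ltf: find P (iota 0 n) < n by rewrite -[n in _ < n](size_iota 0) -has_find.
apply/eqP; rewrite eqn_leq leqNgt; apply/andP; split.
  by apply/negP=> /(before_find 0); rewrite nth_iota // Pi.
rewrite leqNgt; apply/negP=> /minP/negP; apply.
by have := nth_find 0 hasP; rewrite nth_iota.
Qed.

Lemma rec_all_iota (n : seq nat -> nat) (P : nat -> seq nat -> bool) :
  rec (fun e => P (head 0 e) (behead e)) -> rec n ->
  rec (fun e => all (fun k => P k e) (iota 0 (n e))).
Proof.
move=> rP rn.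
apply: rec_ext (rec_iteri (G := fun k r e => r * P k e) _ rn (rec_const 1)).
  move=> e; elim: (n e) => // k IHk.
  by rewrite iteriS IHk iota0S all_cat /= andbT mulnb.
exact: rec_mul (rec_var 1) (rec_skip1 rP).
Qed.

Lemma rec_has_iota (n : seq nat -> nat) (P : nat -> seq nat -> bool) :
  rec (fun e => P (head 0 e) (behead e)) -> rec n ->
  rec (fun e => has (fun k => P k e) (iota 0 (n e))).
Proof.
move=> rP rn; apply: rec_ext (rec_neg (rec_all_iota (rec_neg rP) rn)) => e.
by rewrite -has_predC; congr (nat_of_bool _); apply: eq_has => k; apply: negbK.
Qed.

(** Bounded minimization as a loop: the accumulator equals the counter exactly as long as no witness
    has been met, and stays at the witness afterwards. *)
Lemma rec_find_iota (n : seq nat -> nat) (P : nat -> seq nat -> bool) :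
  rec (fun e => P (head 0 e) (behead e)) -> rec n ->
  rec (fun e => find (fun k => P k e) (iota 0 (n e))).
Proof.
move=> rP rn.
apply: rec_ext (rec_iteri
  (G := fun k r e => if (r == k) && ~~ P k e then k.+1 else r) _ rn (rec_const 0)).
  move=> e; elim: (n e) => // k IHk; rewrite iteriS IHk.
  rewrite iota0S find_cat /= size_iota has_find size_iota.
  set r := find _ _; have: r <= k by rewrite -[k in _ <= k](size_iota 0) find_size.
  by case: ltngtP => //= -> _; case: (P k e); rewrite /= ?addn0 ?addn1.
apply: rec_ite (rec_var 1).
  exact: rec_and (rec_eq (rec_var 1) (rec_var 0)) (rec_neg (rec_skip1 rP)).
exact: rec_succ (rec_var 0).
Qed.

Lemma rec_odd f : rec f -> rec (fun e => odd (f e)).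
Proof.
move=> rf.
apply: rec_ext (rec_iter (G := fun r _ => 1 - r)
  (rec_sub (rec_const 1) (rec_var 0)) rf (rec_const 0)).
by move=> e; elim: (f e) => //= n ->; case: odd.
Qed.

(** The quotient is the least [q] with [f e < q.+1 * g e]. The disjunct [g e == 0] stops the search
    at once, in accordance with division by zero giving [0]. *)
Lemma rec_div f g : rec f -> rec g -> rec (fun e => f e %/ g e).
Proof.
move=> rf rg.
apply: rec_ext (rec_find_iota
  (P := fun q e => (g e == 0) || (f e < q.+1 * g e)) _ (rec_succ rf)).
  move=> e; have [->|d0] := posnP (g e); first by rewrite divn0.
  apply: find_iotaE; first by rewrite ltnS leq_div.
    by rewrite -ltn_divLR // ltnSn orbT.
  by move=> j ltj; rewrite -ltn_divLR // ltnS leqNgt ltj.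
apply: rec_or (rec_eq (rec_weak rg) (rec_const 0)) _.
exact: rec_leq (rec_succ (rec_weak rf)) (rec_mul (rec_succ (rec_var 0)) (rec_weak rg)).
Qed.

(** * Lists of naturals through their codes *)

Definition hd (c : nat) : nat := head 0 (decode c).
Definition tl (c : nat) : nat := code (behead (decode c)).

Lemma codeS x s : code (x :: s) = 2 ^ x * (code s).*2.+1.
Proof. by []. Qed.

Lemma pow2_dvd_code j x s : (2 ^ j.+1 %| code (x :: s)) = (j < x).
Proof.
rewrite codeS; have [ltjx|lexj] := ltnP j x.
  by rewrite dvdn_mulr // dvdn_exp2l.
rewrite -(subnKC lexj) -addnS expnD dvdn_pmul2l ?expn_gt0 // expnS.
by apply/negbTE/negP => /(dvdn_trans (dvdn_mulr _ (dvdnn 2))); rewrite dvdn2 /= odd_double.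
Qed.

(** A nonempty list is coded by a power of two times an odd number, and its head is the 2-adic
    valuation of the code. The code itself bounds the search, as [x < 2 ^ x]; on the code [0] of the
    empty list the range is empty and the default [0] comes out. *)
Lemma rec_hd f : rec f -> rec (fun e => hd (f e)).
Proof.
move=> rf.
apply: rec_ext (rec_find_iota
  (P := fun k e => f e != 2 ^ k.+1 * (f e %/ 2 ^ k.+1)) _ rf).
  move=> e; rewrite -[f e]decodeK /hd codeK; case: (decode (f e)) => //= x s.
  have dvdE k : (code (x :: s) == 2 ^ k.+1 * (code (x :: s) %/ 2 ^ k.+1))
              = (2 ^ k.+1 %| code (x :: s)) by rewrite mulnC eq_sym dvdn_eq.
  rewrite (eq_find (a2 := fun k => x <= k)); last first.
    by move=> k; rewrite dvdE pow2_dvd_code -leqNgt.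
  apply: find_iotaE => //; last by move=> j; rewrite -ltnNge.
  by apply: leq_trans (ltn_expl x (ltnSn 1)) (leq_pmulr _ _).
have rf' := rec_weak rf.
have re : rec (fun e => 2 ^ (head 0 e).+1).
  exact: rec_exp (rec_const 2) (rec_succ (rec_var 0)).
exact: rec_neg (rec_eq rf' (rec_mul re (rec_div rf' re))).
Qed.

Lemma rec_tl f : rec f -> rec (fun e => tl (f e)).
Proof.
move=> rf; apply: rec_ext (rec_div (rec_div rf
  (rec_exp (rec_const 2) (rec_hd rf))) (rec_const 2)) => e.
rewrite -[f e in RHS]decodeK /tl codeK -[f e]decodeK /hd codeK.
case: (decode (f e)) => //= x s.
by rewrite mulKn ?expn_gt0 // divn2 /= uphalf_double.
Qed.

(* Closure properties of functions with values in [seq nat] are stated on the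
   code of the value. *)
Lemma rec_cons f (s : seq nat -> seq nat) :
  rec f -> rec (fun e => code (s e)) -> rec (fun e => code (f e :: s e)).
Proof.
move=> rf rs.
apply: rec_ext (rec_mul (rec_exp (rec_const 2) rf)
  (rec_succ (rec_mul (rec_const 2) rs))) => e.
by rewrite codeS mul2n.
Qed.

Lemma rec_decode f : rec f -> rec (fun e => code (decode (f e))).
Proof. by apply: rec_ext => e; rewrite decodeK. Qed.

Lemma rec_head_seq (s : seq nat -> seq nat) :
  rec (fun e => code (s e)) -> rec (fun e => head 0 (s e)).
Proof. by move=> /rec_hd; apply: rec_ext => e; rewrite /hd codeK. Qed.

Lemma rec_drop f (s : seq nat -> seq nat) :
  rec f -> rec (fun e => code (s e)) -> rec (fun e => code (drop (f e) (s e))).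
Proof.
move=> rf rs.
apply: rec_ext (rec_iter (G := fun r _ => tl r) (rec_tl (rec_var 0)) rf rs).
move=> e; elim: (f e) => [|n /= ->]; first by rewrite drop0.
by rewrite /tl codeK -drop1 drop_drop.
Qed.

Lemma rec_nth_seq f (s : seq nat -> seq nat) :
  rec f -> rec (fun e => code (s e)) -> rec (fun e => nth 0 (s e) (f e)).
Proof.
move=> rf rs; apply: rec_ext (rec_head_seq (rec_drop rf rs)) => e.
by rewrite -nth0 nth_drop addn0.
Qed.

Lemma size_code s : size s <= code s.
Proof.
elim: s => //= x s IHs; rewrite (leq_trans _ (leq_pmull _ _)) ?expn_gt0 //.
by rewrite ltnS (leq_trans IHs) // -addnn leq_addr.
Qed.

Lemma rec_size (s : seq nat -> seq nat) :
  rec (fun e => code (s e)) -> rec (fun e => size (s e)).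
Proof.
move=> rs; apply: rec_ext (rec_find_iota
  (P := fun k e => code (drop k (s e)) == 0) _ (rec_succ rs)).
  move=> e; rewrite (eq_find (a2 := fun k => size (s e) <= k)).
    by apply: find_iotaE => [|//|j]; rewrite ?ltnS ?size_code -?ltnNge.
  move=> k; rewrite -[code _ == 0]/(code _ == code [::]) (can_eq codeK).
  by rewrite -size_eq0 size_drop subn_eq0.
apply: rec_eq (rec_const 0).
apply: rec_drop (rec_var 0) _.
exact: rec_weak rs.
Qed.

(** The loop consumes the list from its end: after [k] rounds the accumulator is the fold of the
    last [k] elements. *)
Lemma rec_foldr (s : seq nat -> seq nat) f (G : nat -> nat -> seq nat -> nat) :
  rec (fun e => G (head 0 e) (head 0 (behead e)) (behead (behead e))) ->
  rec f -> rec (fun e => code (s e)) ->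
  rec (fun e => foldr (fun x r => G x r e) (f e) (s e)).
Proof.
move=> rG rf rs; have rn := rec_size rs.
apply: rec_ext (rec_iteri (G := fun k r e =>
  G (nth 0 (s e) (size (s e) - k.+1)) r e) _ rn rf).
  move=> e; move: (s e) => t.
  transitivity (foldr (fun x r => G x r e) (f e) (drop (size t - size t) t)).
    2: by rewrite subnn drop0.
  suff H k : k <= size t ->
      iteri k (fun k r => G (nth 0 t (size t - k.+1)) r e) (f e)
    = foldr (fun x r => G x r e) (f e) (drop (size t - k) t) by exact: H.
  elim: k => [|k IHk] ltk; first by rewrite subn0 drop_size.
  rewrite iteriS IHk 1?ltnW // [in RHS](drop_nth 0) ?ltn_subrL ?(leq_trans _ ltk) //=.
  by rewrite -subSn // subSS.
have rs2 := rec_weak (rec_weak rs).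
have ri : rec (fun e => nth 0 (s (behead (behead e)))
                          (size (s (behead (behead e))) - (head 0 e).+1)).
  exact: rec_nth_seq (rec_sub (rec_size rs2) (rec_succ (rec_var 0))) rs2.
exact: (rec_skip1' rG ri).
Qed.

Lemma rec_foldr_seq (s t : seq nat -> seq nat)
    (G : nat -> seq nat -> seq nat -> seq nat) :
  rec (fun e => code (G (head 0 e) (decode (head 0 (behead e)))
                        (behead (behead e)))) ->
  rec (fun e => code (t e)) -> rec (fun e => code (s e)) ->
  rec (fun e => code (foldr (fun x r => G x r e) (t e) (s e))).
Proof.
move=> rG rt rs.
apply: rec_ext (rec_foldr (G := fun x r e => code (G x (decode r) e)) rG rt rs).
by move=> e; elim: (s e) => //= x u ->; rewrite codeK.
Qed.

Lemma rec_cat (s t : seq nat -> seq nat) :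
  rec (fun e => code (s e)) -> rec (fun e => code (t e)) ->
  rec (fun e => code (s e ++ t e)).
Proof.
move=> rs rt; apply: rec_ext (rec_foldr_seq (G := fun x r _ => x :: r) _ rt rs).
  by move=> e; congr code; elim: (s e) => //= x u ->.
exact: rec_cons (rec_var 0) (rec_decode (rec_var 1)).
Qed.

Lemma rec_map (s : seq nat -> seq nat) (h : nat -> seq nat -> nat) :
  rec (fun e => h (head 0 e) (behead e)) -> rec (fun e => code (s e)) ->
  rec (fun e => code [seq h x e | x <- s e]).
Proof.
move=> rh rs.
apply: rec_ext (rec_foldr_seq (G := fun x r e => h x e :: r)
                  (t := fun=> [::]) _ (rec_const 0) rs).
  by move=> e; congr code; elim: (s e) => //= x u ->.
exact: rec_cons (rec_skip1 rh) (rec_decode (rec_var 1)).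
Qed.

Lemma rec_ite_seq (b : seq nat -> bool) (s t : seq nat -> seq nat) :
  rec (fun e => b e) -> rec (fun e => code (s e)) -> rec (fun e => code (t e)) ->
  rec (fun e => code (if b e then s e else t e)).
Proof.
move=> rb rs rt; apply: rec_ext (rec_ite rb rs rt) => e.
by case: (b e).
Qed.

Lemma rec_filter (s : seq nat -> seq nat) (P : nat -> seq nat -> bool) :
  rec (fun e => P (head 0 e) (behead e)) -> rec (fun e => code (s e)) ->
  rec (fun e => code [seq x <- s e | P x e]).
Proof.
move=> rP rs.
apply: rec_ext (rec_foldr_seq (G := fun x r e => if P x e then x :: r else r)
                  (t := fun=> [::]) _ (rec_const 0) rs).
  by move=> e; congr code; elim: (s e) => //= x u ->.
apply: rec_ite_seq (rec_skip1 rP) _ (rec_decode (rec_var 1)).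
exact: rec_cons (rec_var 0) (rec_decode (rec_var 1)).
Qed.

Lemma rec_all (s : seq nat -> seq nat) (P : nat -> seq nat -> bool) :
  rec (fun e => P (head 0 e) (behead e)) -> rec (fun e => code (s e)) ->
  rec (fun e => all (fun x => P x e) (s e)).
Proof.
move=> rP rs.
apply: rec_ext (rec_foldr (G := fun x r e => P x e * r)
                  (f := fun=> 1) _ (rec_const 1) rs).
  by move=> e; elim: (s e) => //= x u ->; rewrite mulnb.
exact: rec_mul (rec_skip1 rP) (rec_var 1).
Qed.

Lemma rec_has (s : seq nat -> seq nat) (P : nat -> seq nat -> bool) :
  rec (fun e => P (head 0 e) (behead e)) -> rec (fun e => code (s e)) ->
  rec (fun e => has (fun x => P x e) (s e)).
Proof.
move=> rP rs; apply: rec_ext (rec_neg (rec_all (rec_neg rP) rs)) => e.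
by rewrite -has_predC; congr (nat_of_bool _); apply: eq_has => k; apply: negbK.
Qed.

Lemma rec_mem f (s : seq nat -> seq nat) :
  rec f -> rec (fun e => code (s e)) -> rec (fun e => f e \in s e).
Proof.
move=> rf rs.
have /= := @rec_has s (fun x e => f e == x) (rec_eq (rec_weak rf) (rec_var 0)) rs.
apply: rec_ext => e; congr nat_of_bool.
by rewrite -has_pred1; apply: eq_has => x; rewrite /= eq_sym.
Qed.

Lemma rec_sumn (s : seq nat -> seq nat) :
  rec (fun e => code (s e)) -> rec (fun e => sumn (s e)).
Proof.
move=> rs.
exact: (rec_foldr (G := fun x r _ => x + r)
          (rec_add (rec_var 0) (rec_var 1)) (rec_const 0) rs).
Qed.

Lemma rec_iota f g : rec f -> rec g -> rec (fun e => code (iota (f e) (g e))).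
Proof.
move=> rf rg.
apply: rec_ext (rec_iteri
  (G := fun k r e => code ((f e + g e) - k.+1 :: decode r)) _ rg (rec_const 0)).
  move=> e; suff H k : k <= g e ->
      iteri k (fun k r => code ((f e + g e) - k.+1 :: decode r)) 0
    = code (iota (f e + g e - k) k) by rewrite H // addnK.
  elim: k => // k IHk ltk; rewrite iteriS IHk 1?ltnW // codeK /=.
  by rewrite -subSn ?subSS // (leq_trans ltk) // leq_addl.
cbv beta; apply: rec_cons; last exact: rec_decode (rec_var 1).
apply: rec_sub; last exact: rec_succ (rec_var 0).
exact: (rec_weak (rec_weak (rec_add rf rg))).
Qed.

Definition fld (c j : nat) : nat := nth 0 (decode c) j.

Lemma rec_fld f g : rec f -> rec g -> rec (fun e => fld (f e) (g e)).
Proof. by move=> rf rg; apply: rec_nth_seq rg (rec_decode rf). Qed.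

Definition testbit (v j : nat) : bool := odd (v %/ 2 ^ j).

Lemma rec_testbit f g : rec f -> rec g -> rec (fun e => testbit (f e) (g e)).
Proof.
by move=> rf rg; apply: rec_odd (rec_div rf (rec_exp (rec_const 2) rg)).
Qed.

Create HintDb rec_db discriminated.

(** Syntax-directed proof search: one clause per closure rule, and as a last resort the application
    of a function whose recursiveness in its arguments is recorded in [rec_db]. *)
Ltac rec_tac :=
  cbv beta;
  lazymatch goal with
  | |- rec (fun _ => ?k) => exact: (rec_const k)
  | |- rec (head _) => exact: (rec_var 0)
  | |- rec (fun e => head 0 e) => exact: (rec_var 0)
  | |- rec (fun e => head 0 (behead _)) =>
      first [ exact: (rec_var 1) | exact: (rec_var 2) | exact: (rec_var 3)
            | exact: (rec_var 4) | exact: (rec_var 5) | exact: (rec_var 6)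
            | exact: (rec_var 7) | exact: (rec_var 8) | exact: (rec_var 9)
            | exact: (rec_var 10) | exact: (rec_var 11) | exact: (rec_var 12) ]
  | |- rec (fun e => nat_of_bool (andb _ _)) => apply: rec_and; rec_tac
  | |- rec (fun e => nat_of_bool (orb _ _)) => apply: rec_or; rec_tac
  | |- rec (fun e => nat_of_bool (implb _ _)) => apply: rec_imp; rec_tac
  | |- rec (fun e => nat_of_bool (negb _)) => apply: rec_neg; rec_tac
  | |- rec (fun e => nat_of_bool (@eq_op _ _ _)) =>
      first [apply: rec_eq | apply: rec_eqb]; rec_tac
  | |- rec (fun e => nat_of_bool (leq _ _)) => apply: rec_leq; rec_tac
  | |- rec (fun e => nat_of_bool (if _ then _ else _)) => apply: rec_iteb; rec_tac
  | |- rec (fun e => nat_of_bool (testbit _ _)) => apply: rec_testbit; rec_tac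
  | |- rec (fun e => nat_of_bool (odd _)) => apply: rec_odd; rec_tac
  | |- rec (fun e => nat_of_bool (all _ (iota 0 _))) =>
      apply: rec_all_iota; rec_tac
  | |- rec (fun e => nat_of_bool (has _ (iota 0 _))) =>
      apply: rec_has_iota; rec_tac
  | |- rec (fun e => nat_of_bool (all _ _)) => apply: rec_all; rec_tac
  | |- rec (fun e => nat_of_bool (has _ _)) => apply: rec_has; rec_tac
  | |- rec (fun e => nat_of_bool (in_mem _ _)) => apply: rec_mem; rec_tac
  | |- rec (fun e => if _ then _ else _) => apply: rec_ite; rec_tac
  | |- rec (fun e => S _) => apply: rec_succ; rec_tac
  | |- rec (fun e => addn _ _) => apply: rec_add; rec_tac
  | |- rec (fun e => muln _ _) => apply: rec_mul; rec_tac
  | |- rec (fun e => subn _ _) => apply: rec_sub; rec_tac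
  | |- rec (fun e => expn _ _) => apply: rec_exp; rec_tac
  | |- rec (fun e => fld _ _) => apply: rec_fld; rec_tac
  | |- rec (fun e => size _) => apply: rec_size; rec_tac
  | |- rec (fun e => sumn _) => apply: rec_sumn; rec_tac
  | |- rec (fun e => find _ (iota 0 _)) => apply: rec_find_iota; rec_tac
  | |- rec (fun e => nth 0 _ _) => apply: rec_nth_seq; rec_tac
  | |- rec (fun e => iter _ _ _) => apply: rec_iter; rec_tac
  | |- rec (fun e => code (if _ then _ else _)) => apply: rec_ite_seq; rec_tac
  | |- rec (fun e => code (decode _)) => apply: rec_decode; rec_tac
  | |- rec (fun e => code (_ :: _)) => apply: rec_cons; rec_tac
  | |- rec (fun e => code (_ ++ _)) => apply: rec_cat; rec_tac
  | |- rec (fun e => code (map _ _)) => apply: rec_map; rec_tac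
  | |- rec (fun e => code (filter _ _)) => apply: rec_filter; rec_tac
  | |- rec (fun e => code (iota _ _)) => apply: rec_iota; rec_tac
  | |- rec (fun e => code (foldr _ _ _)) => apply: rec_foldr_seq; rec_tac
  | |- rec (fun e => foldr _ _ _) => apply: rec_foldr; rec_tac
  | |- rec (fun e => nat_of_bool (?g _ _ _ _ _)) =>
      apply: (@rec_app5 (fun a b c d u => g a b c d u));
        [solve [auto with rec_db nocore]|rec_tac..]
  | |- rec (fun e => nat_of_bool (?g _ _ _ _)) =>
      apply: (@rec_app4 (fun a b c d => g a b c d));
        [solve [auto with rec_db nocore]|rec_tac..]
  | |- rec (fun e => nat_of_bool (?g _ _ _)) =>
      apply: (@rec_app3 (fun a b c => g a b c));
        [solve [auto with rec_db nocore]|rec_tac..]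
  | |- rec (fun e => nat_of_bool (?g _ _)) =>
      apply: (@rec_app2 (fun a b => g a b));
        [solve [auto with rec_db nocore]|rec_tac..]
  | |- _ => match goal with
    | |- rec (fun e => ?g _ _ _) =>
        apply: (@rec_app3 g); [solve [auto with rec_db nocore]|rec_tac..]
    | |- rec (fun e => ?g _ _) =>
        apply: (@rec_app2 g); [solve [auto with rec_db nocore]|rec_tac..]
    | |- rec (fun e => ?g _) =>
        apply: (@rec_app1 g); [solve [auto with rec_db nocore]|rec_tac..]
    end
  end.

(** * Folds over codes of formulas *)

(* [nfold G c] is [G c r s] where [r] and [s] are the values at the first two
   components of [c] after its tag; iterating from [0] tabulates the values in
   a list, latest first. *)
Definition nfold_tab (G : nat -> nat -> nat -> nat) (n : nat) : nat :=
  iteri n (fun k r => code (G k (fld r (k - (fld k 1).+1))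
                                (fld r (k - (fld k 2).+1)) :: decode r)) 0.

Definition nfold G c := fld (nfold_tab G c.+1) 0.

Lemma rec_nfold G f :
  rec (fun e => G (head 0 e) (head 0 (behead e)) (head 0 (behead (behead e)))) ->
  rec f -> rec (fun e => nfold G (f e)).
Proof.
move=> rG rf; rewrite /nfold /nfold_tab; apply: rec_fld (rec_const 0).
apply: rec_iteri (rec_succ rf) (rec_const 0).
apply: rec_cons; last by rec_tac.
by apply: (rec_app3 rG); rec_tac.
Qed.

Lemma nfold_tabE G n k : k < n -> fld (nfold_tab G n) (n - k.+1) = nfold G k.
Proof.
elim: n => // n IHn; rewrite ltnS leq_eqVlt => /predU1P[->|ltk].
  by rewrite subnn.
by rewrite -(IHn ltk) subSn // /fld [in LHS]/nfold_tab iteriS codeK.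
Qed.

Lemma fld_lt c j : 0 < c -> fld c j < c.
Proof.
move=> c0; rewrite /fld; have [ltj|lej] := ltnP j (size (decode c)).
  exact: (allP (gtn_decode c)) (mem_nth 0 ltj).
by rewrite nth_default.
Qed.

(** Course-of-values recursion: components of a positive code are smaller than the code, so their
    values are already in the table when [c] is reached. *)
Lemma nfoldE G c :
  0 < c -> nfold G c = G c (nfold G (fld c 1)) (nfold G (fld c 2)).
Proof.
move=> c0; rewrite {1}/nfold {1}/nfold_tab iteriS /fld codeK /=.
by congr G; rewrite -[RHS](nfold_tabE _ (fld_lt _ c0)).
Qed.

(** * Fair paths *)

Section FairPaths.
Variables (S : Type) (E : S -> S -> Prop) (W : S -> Prop).

(** A path with [n.+1] edges, hence never empty; only its interior vertices are required to lie in
    [W]. *)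
Fixpoint pathn n (u v : S) : Prop :=
  if n is m.+1 then exists2 w, W w /\ E u w & pathn m w v else E u v.

Lemma pathn_rcons n u v w : pathn n u v -> W v -> E v w -> pathn n.+1 u w.
Proof.
elim: n u => [|n IHn] u /= => [uv|[x [Wx ux] xv]] Wv vw; first by exists v.
by exists x => //; apply: IHn xv Wv vw.
Qed.

Variables (F : nat -> S -> Prop) (J : nat).
Hypothesis J_gt0 : 0 < J.
Hypothesis progress : forall w j, W w -> j < J ->
  exists n v, [/\ W v, F j v & pathn n w v].

(* The path visits [F 0], ..., [F J.-1] in turn; at each step it goes to a
   successor that is closer to the current target. *)
Lemma round_robin w0 : W w0 ->
  exists rho : nat -> S,
    [/\ rho 0 = w0, forall k, W (rho k), forall k, E (rho k) (rho k.+1) &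
        forall j k, j < J -> exists2 l, k < l & F j (rho l)].
Proof.
move=> Ww0.
pose near n w j := exists v, [/\ W v, F j v & pathn n w v].
(* The successor is taken on a shortest path, so that one choice of [u] decreases every bound [n] on
   the distance to the target. *)
have next wj : exists u, W wj.1 -> wj.2 < J ->
    [/\ W u, E wj.1 u &
        forall n, near n wj.1 wj.2 -> F wj.2 u \/ exists2 m, m < n & near m u wj.2].
  case: wj => w j /=.
  have [Ww|] := pselect (W w); last by exists w.
  have [ltj|] := boolP (j < J); last by exists w.
  have exn : exists n, `[< near n w j >].
    by have [n [v ?]] := progress Ww ltj; exists n; apply/asboolP; exists v.
  case: (ex_minnP exn) => n /asboolP[v [Wv Fv]] pth minn.
  case: n pth minn => [|n] /=.
    by move=> wv _; exists v => _ _; split=> // n _; left.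
  move=> [u [Wu wu] uv] minn; exists u => _ _; split=> // m /asboolP/minn ltm.
  by right; exists n => //; exists v.
have [nx nxP] := choice next.
(* The second component counts the targets hit so far; its residue modulo [J] is the current
   target. *)
pose st := fix st k := if k is k'.+1 then
    let: (w, T) := st k' in let u := nx (w, T %% J) in
    (u, if `[< F (T %% J) u >] then T.+1 else T) else (w0, 0).
have stS k : st k.+1 = (nx ((st k).1, (st k).2 %% J),
    if `[< F ((st k).2 %% J) (nx ((st k).1, (st k).2 %% J)) >]
    then (st k).2.+1 else (st k).2).
  by rewrite /=; case: (st k).
have Wst k : W (st k).1.
  elim: k => // k IHk; rewrite stS /=.
  by have [] := nxP ((st k).1, (st k).2 %% J) IHk (ltn_pmod _ J_gt0).
have Est k : E (st k).1 (st k.+1).1.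
  rewrite stS /=.
  by have [] := nxP ((st k).1, (st k).2 %% J) (Wst k) (ltn_pmod _ J_gt0).
exists (fun k => (st k).1); split=> // j k ltj.
have hit n l : near n (st l).1 ((st l).2 %% J) ->
    exists l', [/\ l < l', (st l').2 = (st l).2.+1 & F ((st l).2 %% J) (st l').1].
  elim: n {-2}n (leqnn n) l => [|b IHb] n len l nr.
    move: len nr; rewrite leqn0 => /eqP-> nr.
    have [_ _ /(_ _ nr)[Fu|[]//]] := nxP ((st l).1, (st l).2 %% J) (Wst l) (ltn_pmod _ J_gt0).
    by exists l.+1; rewrite stS /= asboolT.
  have [_ _ /(_ _ nr)] := nxP ((st l).1, (st l).2 %% J) (Wst l) (ltn_pmod _ J_gt0).
  have [Fu _|nF [//|[m ltm nrm]]] := pselect (F ((st l).2 %% J) (nx ((st l).1, (st l).2 %% J))).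
    by exists l.+1; rewrite stS /= asboolT.
  have TE : (st l.+1).2 = (st l).2 by rewrite stS /= asboolF.
  have [||l' [ltl' TE' Fl']] := IHb m _ l.+1.
  - by rewrite -ltnS (leq_trans ltm).
  - by rewrite TE stS.
  by exists l'; rewrite TE in TE' Fl'; split=> //; apply: ltnW.
have hitn d : exists l', [/\ k < l', (st l').2 = ((st k).2 + d).+1 &
                            F (((st k).2 + d) %% J) (st l').1].
  elim: d => [|d [l [ltl TE _]]].
    have [n [v nr]] := progress (Wst k) (ltn_pmod (st k).2 J_gt0).
    by rewrite addn0; apply: (hit n); exists v.
  have [n [v nr]] := progress (Wst l) (ltn_pmod (st l).2 J_gt0).
  have [|l' [ltl' TE' Fl']] := hit n l; first by exists v.
  by exists l'; rewrite addnS -TE; split=> //; apply: ltn_trans ltl'.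
(* The number [(st k).2 * J + j] is congruent to [j] and not below the present count, so the hit
   with this number comes after [k] and is a visit of [F j]. *)
have leT : (st k).2 <= (st k).2 * J + j by rewrite (leq_trans (leq_pmulr _ J_gt0)) ?leq_addr.
have [l [ltl _ Fl]] := hitn ((st k).2 * J + j - (st k).2).
by exists l => //; move: Fl; rewrite subnKC // modnMDl modn_small.
Qed.

End FairPaths.

(** * Linear-time semantics of path formulas *)

Section Words.
Variable AP : finType.
Implicit Types (f g : pformula AP) (xs : seq var) (t : trajectory).
Implicit Types (sigma : var -> trace AP).

Definition word := nat -> AP -> var -> bool.

Fixpoint ev (w : word) k f : Prop :=
  match f with
  | PTrue => True
  | PAtom a x => w k a x
  | PNot f => ~ ev w k f
  | POr f g => ev w k f \/ ev w k g
  | PUntil f g => exists i, ev w (k + i) g /\ forall j, j < i -> ev w (k + j) f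
  | PNext f => ev w k.+1 f
  end.

Fixpoint pos t (x : var) k : nat := if k is l.+1 then pos t x l + t l x else 0.

(** Fixing the traces and the trajectory turns the asynchronous semantics into ordinary LTL over a
    single word of indexed atoms. *)
Definition tword xs sigma t : word :=
  fun k a x => (x \in xs) && (a \in sigma x (pos t x k)).

Definition assign xs sigma : assignment AP :=
  fun x => if x \in xs then Some (sigma x, 0) else None.

Definition ftraj xs t : Prop :=
  trajectory_over (mem xs) t /\ fair (mem xs) t.

Lemma iter_succ_assign xs sigma t k :
  iter k (@succ AP) (assign xs sigma, t) =
  (fun x => if x \in xs then Some (sigma x, pos t x k) else None,
   fun j => t (k + j)).
Proof.
elim: k => // k; rewrite iterS => ->; rewrite /succ /=; congr pair.
  apply/funext=> x; case: (x \in xs) => //; rewrite addn0.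
  by case: (t k x); rewrite ?addn1 ?addn0.
by apply/funext=> j; rewrite addnS.
Qed.

Lemma psat_ev xs sigma t k f :
  psat (iter k (@succ AP) (assign xs sigma, t)) f <-> ev (tword xs sigma t) k f.
Proof.
elim: f k => //= [a x|f IHf|f IHf g IHg|f IHf g IHg|f IHf] k.
- by rewrite iter_succ_assign /tword /=; case: (x \in xs).
- by rewrite IHf.
- by rewrite IHf IHg.
- split=> -[i [gi fj]]; exists i; split.
  + by apply/IHg; rewrite addnC iterD; exact: gi.
  + by move=> j /fj fkj; apply/IHf; rewrite addnC iterD; exact: fkj.
  + by move/IHg: gi; rewrite addnC iterD.
  + by move=> j /fj/IHf; rewrite addnC iterD.
- exact: (IHf k.+1).
Qed.

Lemma dom_assign xs sigma : dom (assign xs sigma) = mem xs :> (var -> bool).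
Proof. by apply/funext=> x; rewrite /dom /assign /=; case: (x \in xs). Qed.

Lemma sat_ModE K xs sigma f :
  sat K (assign xs sigma) (Traj ModE f) <->
  exists2 t, ftraj xs t & ev (tword xs sigma t) 0 f.
Proof.
rewrite /= dom_assign; split=> [[t [t1 t2 /(psat_ev _ _ _ 0)]]|[t [t1 t2] /(psat_ev _ _ _ 0)]].
  by exists t.
by exists t.
Qed.

Lemma sat_ModA K xs sigma f :
  sat K (assign xs sigma) (Traj ModA f) <->
  forall t, ftraj xs t -> ev (tword xs sigma t) 0 f.
Proof.
rewrite /= dom_assign; split=> [st t [t1 t2]|st t t1 t2].
  by apply/(psat_ev _ _ _ 0)/st.
by apply/(psat_ev _ _ _ 0)/st.
Qed.

Lemma sat_prefixed_Exists (K : kripke AP) Pi xs M f :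
  sat K Pi (prefixed Exists xs M f) <->
  exists2 sigma, {in xs, forall x, is_trace K (sigma x)} &
    sat K (fun y => if y \in xs then Some (sigma y, 0) else Pi y) (Traj M f).
Proof.
elim: xs Pi => [|x xs IHxs] Pi.
  split=> [st|[_ _ //]]; exists (fun=> fun=> set0) => //.
split=> [[s [s_tr /IHxs[sigma sg_tr st]]]|[sigma sg_tr st]].
  (* If a variable is bound twice, the inner binder wins, so [sigma] takes precedence over [s]. *)
  exists (fun y => if y \in xs then sigma y else s) => [y|].
    by case: ifP => [/sg_tr|].
  move: st; congr sat; apply/funext=> y; rewrite inE /update.
  by case: (y \in xs); rewrite ?orbT ?orbF.
exists (sigma x); split; first by apply: sg_tr; rewrite inE eqxx.
apply/IHxs; exists sigma => [y yxs|]; first by apply: sg_tr; rewrite inE yxs orbT.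
move: st; congr sat; apply/funext=> y; rewrite inE /update.
by case: (y \in xs); rewrite ?orbT ?orbF //; case: eqP => [->|].
Qed.

Definition dual_mod M := match M with ModE => ModA | ModA => ModE end.

Lemma sat_prefixed_Forall (K : kripke AP) Pi xs M f :
  sat K Pi (prefixed Forall xs M f) <->
  ~ sat K Pi (prefixed Exists xs (dual_mod M) (PNot f)).
Proof.
elim: xs Pi => [|x xs IHxs] Pi /=.
  case: M => /=; split.
  - by move=> [t [t1 t2 ft]] /(_ t t1 t2).
  - by apply: contra_notP => nex t t1 t2 ft; apply: nex; exists t.
  - by move=> st [t [t1 t2]]; apply; apply: st.
  - by move=> nex t t1 t2; apply: contra_notP nex => nft; exists t.
split.
  by move=> st [s [s_tr]]; apply/IHxs/st.
by move=> nex s s_tr; apply/IHxs => st; apply: nex; exists s.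
Qed.

Lemma models_Exists (K : kripke AP) xs M f :
  models K (prefixed Exists xs M f) <->
  exists2 sigma, {in xs, forall x, is_trace K (sigma x)} &
    sat K (assign xs sigma) (Traj M f).
Proof. exact: sat_prefixed_Exists. Qed.

(** * Pointers along a fair trajectory *)

Lemma pos_le t x k l : k <= l -> pos t x k <= pos t x l.
Proof.
move=> /subnK <-; elim: (l - k) => // d IHd.
by rewrite addSn /= (leq_trans IHd) ?leq_addr.
Qed.

(** Fairness makes the pointer move again and again, and each move advances it by one only, so no
    position is skipped. *)
Lemma pos_unbounded xs t x : ftraj xs t -> x \in xs ->
  forall p, exists k, pos t x k = p.
Proof.
move=> [_ fr] xxs; elim=> [|p [k posk]]; first by exists 0.
have ex : exists l, (k <= l) && t l x by have [l ? ?] := fr x xxs k; exists l; apply/andP.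
case: (ex_minnP ex) => l /andP[lekl tl] minl; exists l.+1.
rewrite /= tl addn1; congr _.+1; rewrite -posk.
have stay d : k + d <= l -> pos t x (k + d) = pos t x k.
  elim: d => [|d IHd]; rewrite ?addn0 // addnS => ltd /=.
  rewrite IHd 1?ltnW //; case tx: (t _ _); rewrite ?addn0 //.
  by have := minl (k + d); rewrite leq_addr tx leqNgt ltd => /(_ isT).
by rewrite -[l](subnKC lekl) stay // subnKC.
Qed.

(** [T k] is the first time at which the pointer is at [k]. The intervals between these times are
    the stuttering blocks; they also serve to read a trace off a path of the tableau. *)
Lemma switch_times xs t x : ftraj xs t -> x \in xs ->
  exists T : nat -> nat,
    [/\ T 0 = 0, forall k, T k < T k.+1 &
        forall k l, (T k <= l < T k.+1) = (pos t x l == k)].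
Proof.
move=> ft xxs.
have ex k : exists l, k <= pos t x l.
  by have [l <-] := pos_unbounded ft xxs k; exists l.
pose T k := ex_minn (ex k); have T_le k l : (T k <= l) = (k <= pos t x l).
  rewrite /T; case: ex_minnP => m km minm; apply/idP/idP; last exact: minm.
  by move/(pos_le t x); apply: leq_trans.
exists T; split=> [|k|k l].
- by apply/eqP; rewrite -leqn0 T_le.
- rewrite ltnNge T_le; apply/negP => le1.
  case Tk: (T k) le1 => [|m] //= le1.
  have : ~~ (T k <= m) by rewrite Tk ltnn.
  rewrite T_le -ltnNge => ltk.
  have := leq_trans le1 (leq_add (leqnn _) (leq_b1 _)).
  by rewrite addn1 ltnS leqNgt ltk.
- by rewrite ltnNge !T_le -ltnNge ltnS -eqn_leq eq_sym.
Qed.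

End Words.

(** * Eliminating universally quantified trajectories *)

Section Universal.
Variable AP : finType.
Implicit Types (f g : pformula AP) (xs : seq var).
Implicit Types (sigma : var -> trace AP) (w : word AP).
Implicit Types (L : seq (AP * var * var)).

Definition PFalse : pformula AP := PNot PTrue.
Definition bigor (fs : seq (pformula AP)) := foldr (@POr AP) PFalse fs.
Definition bigand (fs : seq (pformula AP)) := foldr (@PAnd AP) PTrue fs.

Lemma ev_and w k f g : ev w k (PAnd f g) <-> ev w k f /\ ev w k g.
Proof.
rewrite /=; split=> [nn|[ef eg] []//].
by split; apply: contrapT => n; apply: nn; [left|right].
Qed.

Lemma ev_or w k f g : ev w k (POr f g) <-> ev w k f \/ ev w k g.
Proof. by []. Qed.

Lemma ev_impl w k f g : ev w k (PImpl f g) <-> (ev w k f -> ev w k g).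
Proof.
rewrite /=; split=> [[nf /nf//|//]|fg].
by have [/fg|] := pselect (ev w k f); [right|left].
Qed.

Lemma ev_iff w k f g : ev w k (PIff f g) <-> (ev w k f <-> ev w k g).
Proof. by rewrite /PIff ev_and !ev_impl. Qed.

Lemma ev_box w k f : ev w k (PBox f) <-> forall i, ev w (k + i) f.
Proof.
rewrite /=; split=> [nn i|ef [i [nf _]]]; last exact: nf.
by apply: contrapT => nf; apply: nn; exists i.
Qed.

Lemma ev_bigor w k (T : eqType) (F : T -> pformula AP) (s : seq T) :
  ev w k (bigor [seq F i | i <- s]) <-> exists2 i, i \in s & ev w k (F i).
Proof.
elim: s => [|i s IHs] /=; first by split=> [[]//|[]].
rewrite IHs; split=> [[Fi|[j js Fj]]|[j]].
- by exists i; rewrite ?mem_head.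
- by exists j; rewrite // inE js orbT.
- by rewrite inE => /predU1P[->|js] Fj; [left|right; exists j].
Qed.

Lemma ev_bigand w k (T : eqType) (F : T -> pformula AP) (s : seq T) :
  ev w k (bigand [seq F i | i <- s]) <-> {in s, forall i, ev w k (F i)}.
Proof.
elim: s => [|i s IHs]; first by split.
rewrite -[bigand _]/(PAnd (F i) (bigand [seq F i | i <- s])) ev_and IHs.
split=> [[Fi Fs] j|Fs]; first by rewrite inE => /predU1P[->|/Fs].
split=> [|j js]; first by apply: Fs; rewrite mem_head.
by apply: Fs; rewrite inE js orbT.
Qed.

(** [PIff] unfolds into two disjunctions of this shape. The test [x == y] keeps monadic formulas
    free of triples, which is how the phase formula is told apart from them. *)
Definition imp_triple f g : seq (AP * var * var) :=
  match f, g with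
  | PNot (PAtom a x), PAtom _ y => if x == y then [::] else [:: (a, x, y)]
  | _, _ => [::]
  end.

(* [triples f] collects the implications [a_x -> a_y] of the atomic phase
   formulas in [f]; no state formula or monadic formula contributes to
   [phase_triples]. *)
Fixpoint triples f : seq (AP * var * var) :=
  match f with
  | PTrue | PAtom _ _ => [::]
  | PNot f | PNext f => triples f
  | POr f g => imp_triple f g ++ triples f ++ triples g
  | PUntil f g => triples f ++ triples g
  end.

Fixpoint phase_triples f : seq (AP * var * var) :=
  match f with
  | PNot f => phase_triples f
  | POr f g => phase_triples f ++ phase_triples g
  | PUntil f g => triples f ++ triples g
  | _ => [::]
  end.

(** Phase and co-phase formulas share the core [PUntil PTrue (PNot R)], and [b] is the truth value
    given to this core: [false] stands for aligned trajectories. An until without triples is monadic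
    or has a trivial [R], and is kept. *)
Fixpoint subst_phase (b : bool) f : pformula AP :=
  match f with
  | PNot f => PNot (subst_phase b f)
  | POr f g => POr (subst_phase b f) (subst_phase b g)
  | PUntil f g => if nilp (triples f ++ triples g) then PUntil f g
                  else if b then PTrue else PFalse
  | _ => f
  end.

Definition diff (a : AP) (x : var) :=
  PNot (PIff (PAtom a x) (PNext (PAtom a x))).
Definition const (a : AP) (x : var) :=
  POr (PBox (PAtom a x)) (PBox (PNot (PAtom a x))).

Fixpoint subs (T : Type) (s : seq T) : seq (seq T) :=
  if s is x :: s then subs s ++ [seq x :: u | u <- subs s] else [:: [::]].

(** One reason why [N] cannot be the part of [C] that moves first: [a] would change in [x] but not
    in [y], because [y] moves too without changing [a], or stays behind in [C], or lies outside [C]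
    and never changes [a] again. *)
Definition blocked (C N : seq var) (t : AP * var * var) : pformula AP :=
  let: (a, x, y) := t in
  if x \in N then
    PAnd (diff a x) (if y \in N then PNot (diff a y)
                     else if y \in C then PTrue else const a y)
  else PFalse.

(* Some nonempty set [C] of traces can never move again: no nonempty part [N]
   of [C] can be the first to move. *)
Definition stuck xs L : pformula AP :=
  bigor [seq bigand [seq bigor [seq blocked C N t | t <- L]
                    | N <- subs C & N != [::]]
        | C <- subs xs & C != [::]].

Definition in_phase L : pformula AP :=
  bigand [seq PImpl (PAtom t.1.1 t.1.2) (PAtom t.1.1 t.2) | t <- L].

Definition always_in_phase L : pformula AP :=
  bigand [seq POr (PBox (PNot (PAtom t.1.1 t.1.2))) (PBox (PAtom t.1.1 t.2))
         | t <- L].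

Definition never_aligned xs L : pformula AP :=
  POr (PNot (in_phase L))
      (PUntil (in_phase L) (PAnd (in_phase L) (stuck xs L))).

Definition forall_traj xs f : pformula AP :=
  let L := phase_triples f in
  POr (PAnd (subst_phase false f) (subst_phase true f))
  (POr (PAnd (subst_phase false f) (always_in_phase L))
       (PAnd (subst_phase true f) (never_aligned xs L))).

(** ** Boolean combinations with one phase formula *)

Lemma imp_tripleP f g t : t \in imp_triple f g ->
  [/\ t.1.2 <> t.2, t.1.2 \in pvars f & t.2 \in pvars g].
Proof.
case: f => [|a x|[|a x|f|f f'|f f'|f]|f f'|f f'|f] //.
case: g => // b y /=; case: eqP => // nxy.
by rewrite inE => /eqP-> /=; rewrite !inE !eqxx.
Qed.

Lemma triplesP f t : t \in triples f ->
  [/\ t.1.2 <> t.2, t.1.2 \in pvars f & t.2 \in pvars f].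
Proof.
elim: f => //= [f IHf g IHg|f IHf g IHg].
  rewrite !mem_cat => /orP[/imp_tripleP|/orP[/IHf|/IHg]] [n -> ->];
  by rewrite ?orbT; split.
rewrite !mem_cat => /orP[/IHf|/IHg] [n -> ->];
by rewrite ?orbT; split.
Qed.

Lemma phase_triplesP f t : t \in phase_triples f ->
  [/\ t.1.2 <> t.2, t.1.2 \in pvars f & t.2 \in pvars f].
Proof.
elim: f => //= [f IHf g IHg|f IHf g IHg].
  rewrite !mem_cat => /orP[/IHf|/IHg] [n -> ->];
  by rewrite ?orbT; split.
rewrite !mem_cat => /orP[/triplesP|/triplesP] [n -> ->];
by rewrite ?orbT; split.
Qed.

Lemma phase_triples_monadic x f :
  {subset pvars f <= [:: x]} -> phase_triples f = [::].
Proof.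
move=> fx; case E: (phase_triples f) => [//|t s].
have := @phase_triplesP f t; rewrite E mem_head => /(_ isT)[n /fx + /fx].
by rewrite !inE => /eqP + /eqP; rewrite -{2}[x]/x => <- /esym/n.
Qed.

Lemma subst_phase_id b f : phase_triples f = [::] -> subst_phase b f = f.
Proof.
elim: f => //= [f IHf /IHf->//|f IHf g IHg|f IHf g IHg -> //].
by move/nilP; rewrite cat_nilp => /andP[/nilP/IHf-> /nilP/IHg->].
Qed.

Definition in_phase_at w L k : Prop :=
  forall t, t \in L -> w k t.1.1 t.1.2 -> w k t.1.1 t.2.

Lemma ev_in_phase w L k : ev w k (in_phase L) <-> in_phase_at w L k.
Proof.
rewrite ev_bigand; split=> H t tL; first by have /ev_impl := H t tL.
exact/ev_impl/H.
Qed.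

Definition symmetric_triples L : Prop :=
  forall a x y, (a, x, y) \in L -> (a, y, x) \in L.

Lemma in_phase_cat w L1 L2 k :
  in_phase_at w (L1 ++ L2) k <-> in_phase_at w L1 k /\ in_phase_at w L2 k.
Proof.
split=> [H|[H1 H2] t]; last by rewrite mem_cat => /orP[/H1|/H2].
by split=> t tL; apply: H; rewrite mem_cat tL ?orbT.
Qed.

Lemma symmetric_triples_cat L1 L2 :
  symmetric_triples L1 -> symmetric_triples L2 -> symmetric_triples (L1 ++ L2).
Proof.
by move=> s1 s2 a x y; rewrite !mem_cat => /orP[/s1->|/s2->]; rewrite ?orbT.
Qed.

Lemma triples_and f g : triples (PAnd f g) = triples f ++ triples g.
Proof. by rewrite /=; case: f. Qed.

(** Used at both levels of conjunction: inside an atomic phase formula and over atomic phase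
    formulas. *)
Lemma conj_of_phase (X : pformula AP -> Prop) R :
  (forall f, X f -> symmetric_triples (triples f) /\
     forall w k, ev w k f <-> in_phase_at w (triples f) k) ->
  conj_of X R ->
  symmetric_triples (triples R) /\
  forall w k, ev w k R <-> in_phase_at w (triples R) k.
Proof.
move=> XP; elim=> [|f /XP//|f g _ [sf IHf] _ [sg IHg]].
  by split=> // w k; split=> // _ t.
rewrite triples_and; split=> [|w k]; first exact: symmetric_triples_cat.
by rewrite ev_and IHf IHg in_phase_cat.
Qed.

Lemma triples_conj_atomic_phase R : conj_of (@atomic_phase AP) R ->
  symmetric_triples (triples R) /\
  forall w k, ev w k R <-> in_phase_at w (triples R) k.
Proof.
apply: conj_of_phase => f [x [y [nxy cf]]]; move: cf.
apply: conj_of_phase => _ [a ->].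
have -> : triples (PIff (PAtom a x) (PAtom a y)) = [:: (a, x, y); (a, y, x)].
  by rewrite /= (introF eqP nxy) eq_sym (introF eqP nxy).
split=> [b u v|w k]; first by rewrite !inE => /orP[/eqP[-> -> ->]|/eqP[-> -> ->]]; rewrite eqxx ?orbT.
rewrite ev_iff /=; split=> [H t|H].
  by rewrite !inE => /orP[/eqP->|/eqP->] /H.
by split=> wk; [apply: (H (a, x, y))|apply: (H (a, y, x))]; rewrite ?inE ?eqxx ?orbT.
Qed.

Lemma bool_comb_mono (X Y : bool -> pformula AP -> Prop) k b f :
  (forall b g, X b g -> Y b g) -> bool_comb X k b f -> bool_comb Y k b f.
Proof.
move=> XY; elim=> *; by [constructor|constructor; apply: XY].
Qed.

(** Disregarding the polarity makes the class closed under negation, as the duality of quantifiers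
    demands. *)
Definition phase_or_co (b : bool) f : Prop := phase f \/ co_phase f.

Lemma flip_polarity k b f :
  bool_comb phase_or_co k b f -> bool_comb phase_or_co k (~~ b) f.
Proof. by elim=> *; constructor. Qed.

Lemma in_class_phase C f : in_class C f -> bool_comb phase_or_co 1 true f.
Proof.
by case: C; apply: bool_comb_mono => b g; [left|case=> _; right].
Qed.

(** * Dependence of the body on the trajectory *)

Section OneTuple.
Variables (xs : seq var) (sigma : var -> trace AP).
Local Notation wd t := (tword xs sigma t).

Definition indep f : Prop := forall t t', ftraj xs t -> ftraj xs t' ->
  ev (wd t) 0 f -> ev (wd t') 0 f.

Lemma indep_not f : indep f -> indep (PNot f).
Proof. by move=> If t t' ft ft' nf /(If _ _ ft' ft)/nf. Qed.

Lemma indep_or f g : indep f -> indep g -> indep (POr f g).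
Proof.
by move=> If Ig t t' ft ft' [/(If _ _ ft ft')|/(Ig _ _ ft ft')]; [left|right].
Qed.

Lemma indep_state f : state_formula f -> indep f.
Proof.
elim: f => // [a x|f IHf|f IHf g IHg].
- by move=> _ t t'.
- by move=> /IHf/indep_not.
- by move=> [/IHf If /IHg]; apply: indep_or.
Qed.

Lemma state_phase_triples f : state_formula f -> phase_triples f = [::].
Proof. by elim: f => //= f IHf g IHg [/IHf fn /IHg gn]; rewrite fn gn. Qed.

(** Along any fair trajectory the letters of [x] form a stuttering of the same trace; the switch
    times of the two trajectories are the index sequences of the stuttering equivalence. A variable
    outside [xs] reads a constant word. *)
Lemma indep_monadic f : monadic_formula f -> indep f.
Proof.
move=> [[x fx] inv] t t' ft ft'.
pose tau t : trace AP := fun k => if x \in xs then sigma x (pos t x k) else set0.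
have evE u k : ev (wd u) k f <-> ltl (tau u) k f.
  elim: f k fx {inv} => //= [a y|f IHf|f IHf g IHg|f IHf g IHg|f IHf] k fx.
  - have /eqP-> : y == x by have := fx y; rewrite !inE eqxx => /(_ isT).
    by rewrite /tword /tau; case: (x \in xs); rewrite ?inE.
  - by rewrite IHf.
  - have [fx1 fx2] : {subset pvars f <= [:: x]} /\ {subset pvars g <= [:: x]}.
      by split=> y yf; apply: fx; rewrite mem_cat yf ?orbT.
    by rewrite IHf // IHg.
  - have [fx1 fx2] : {subset pvars f <= [:: x]} /\ {subset pvars g <= [:: x]}.
      by split=> y yf; apply: fx; rewrite mem_cat yf ?orbT.
    split=> -[i [gi fj]]; exists i.
      by split=> [|j /fj /(IHf _ fx1)//]; apply/(IHg _ fx2).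
    by split=> [|j /fj /(IHf _ fx1)//]; apply/(IHg _ fx2).
  - exact: IHf.
rewrite !evE; have -> // : ltl (tau t) 0 f <-> ltl (tau t') 0 f.
apply: inv; rewrite /tau; case: (boolP (x \in xs)) => [xxs|_].
  have [T [T0 Tlt TE]] := switch_times ft xxs.
  have [T' [T'0 T'lt T'E]] := switch_times ft' xxs.
  exists T, T'; split=> // k l l'; rewrite TE T'E.
  by move=> /eqP-> /eqP->.
by exists id, id.
Qed.

Definition aligned t L : Prop := forall k, in_phase_at (wd t) L k.

(** The core says precisely that the trajectory is not aligned, so alignment decides which constant
    may replace it. If [R] has no triples the core is kept, being false on all trajectories. *)
Lemma phase_core R (D := PUntil PTrue (PNot R)) :
  conj_of (@atomic_phase AP) R ->
  [/\ symmetric_triples (phase_triples D),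
      forall t, aligned t (phase_triples D) ->
        (ev (wd t) 0 D <-> ev (wd t) 0 (subst_phase false D)),
      forall t, ~ aligned t (phase_triples D) ->
        (ev (wd t) 0 D <-> ev (wd t) 0 (subst_phase true D)) &
      forall b, indep (subst_phase b D)].
Proof.
move=> /triples_conj_atomic_phase[symR evR].
have DE t : ev (wd t) 0 D <-> ~ aligned t (triples R).
  rewrite /D /=; split=> [[i [nR _]] al|].
    by apply/nR/evR/al.
  by move=> /existsNP[i ni]; exists i; split=> // /evR.
rewrite /= in DE *; split=> // [t al|t nal|b].
- by rewrite DE; case: nilp => /=; rewrite ?DE; split=> // [[]].
- by rewrite DE; case: nilp => /=; rewrite ?DE; split.
case: nilP => [RE|_]; last by case: b => t t' _ _ /=.
move=> t t' _ _ /DE; case=> k u.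
by rewrite RE.
Qed.

(** The count tells which side of a disjunction carries the phase formula; the other side
    contributes no triples and is unaffected by the substitution. *)
Lemma bool_comb_phase k b f : bool_comb phase_or_co k b f ->
  (k = 0 -> phase_triples f = [::] /\ indep f) /\
  (k = 1 -> [/\ symmetric_triples (phase_triples f),
      forall t, aligned t (phase_triples f) ->
        (ev (wd t) 0 f <-> ev (wd t) 0 (subst_phase false f)),
      forall t, ~ aligned t (phase_triples f) ->
        (ev (wd t) 0 f <-> ev (wd t) 0 (subst_phase true f)) &
      forall b, indep (subst_phase b f)]).
Proof.
elim=> {k b f}.
- by move=> b f sf; split=> // _; split; [exact: state_phase_triples|exact: indep_state].
- move=> b f mf; split=> // _; split; last exact: indep_monadic.
  by case: mf => [[x fx] _]; apply: phase_triples_monadic fx.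
- move=> b f [[R /phase_core H ->]|[R /phase_core H ->]]; split=> // _.
  case: H => [s e1 e2 i]; split=> //.
  + by move=> t /e1; apply: not_iff_compat.
  + by move=> t /e2; apply: not_iff_compat.
  + by move=> c; apply/indep_not/i.
- move=> k b f _ [IH0 IH1]; split=> [/IH0[fn If]|/IH1[s e1 e2 i]].
    by split=> //; apply: indep_not.
  split=> //.
  + by move=> t /e1; apply: not_iff_compat.
  + by move=> t /e2; apply: not_iff_compat.
  + by move=> c; apply/indep_not/i.
- move=> k l b f g _ [If0 If1] _ [Ig0 Ig1]; split.
    case: k l If0 Ig0 {If1 Ig1} => [|//] [|//] /(_ erefl)[fn If] /(_ erefl)[gn Ig] _.
    by split; [rewrite /= fn gn|exact: indep_or].
  case: k l If0 If1 Ig0 Ig1 => [|[|//]] [|[|//]] // If0 If1 Ig0 Ig1 _.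
    have [fn If] := If0 erefl; have [s e1 e2 i] := Ig1 erefl.
    rewrite /= fn /=; split=> //.
    + by move=> t /e1 ->; rewrite (subst_phase_id _ fn).
    + by move=> t /e2 ->; rewrite (subst_phase_id _ fn).
    + by move=> c; rewrite (subst_phase_id _ fn); apply: indep_or.
  have [gn Ig] := Ig0 erefl; have [s e1 e2 i] := If1 erefl.
  rewrite /= gn cats0; split=> //.
  + by move=> t /e1 ->; rewrite (subst_phase_id _ gn).
  + by move=> t /e2 ->; rewrite (subst_phase_id _ gn).
  + by move=> c; rewrite (subst_phase_id _ gn); apply: indep_or.
Qed.

End OneTuple.
End Universal.

(** * Obstructions to alignment *)

Section Subs.
Variable T : eqType.
Implicit Types s u : seq T.

Lemma mem_subs s u : u \in subs s -> {subset u <= s}.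
Proof.
elim: s u => [|x s IHs] u /=; first by rewrite inE => /eqP->.
rewrite mem_cat => /orP[/IHs us y /us|/mapP[v /IHs vs ->] y].
  by rewrite inE orbC => ->.
by rewrite !inE => /predU1P[->|/vs->]; rewrite ?eqxx ?orbT.
Qed.

Lemma filter_subs (P : pred T) s : filter P s \in subs s.
Proof.
elim: s => //= x s IHs; rewrite mem_cat; case: (P x); rewrite ?IHs //.
by rewrite map_f ?orbT.
Qed.

End Subs.

Section Alignment.
Variable AP : finType.
Variables (xs : seq var) (sigma : var -> trace AP).
Variable L : seq (AP * var * var).
Hypothesis L_sym : symmetric_triples L.
Hypothesis L_neq : forall a x y, (a, x, y) \in L -> x <> y.
Hypothesis L_xs : forall a x y, (a, x, y) \in L -> x \in xs.
Local Notation wd t := (tword xs sigma t).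
Implicit Types (a : AP) (x y : var) (t : trajectory).

Lemma L_xs2 a x y : (a, x, y) \in L -> y \in xs.
Proof. by move=> /L_sym/L_xs. Qed.

Lemma in_phase_eq t k : in_phase_at (wd t) L k <-> forall a x y, (a, x, y) \in L ->
  (a \in sigma x (pos t x k)) = (a \in sigma y (pos t y k)).
Proof.
split=> [H a x y aL|H [[a x] y] aL]; last first.
  by rewrite /tword /= (L_xs aL) (L_xs2 aL) (H _ _ _ aL).
have := H _ aL; have := H _ (L_sym aL).
by rewrite /tword /= (L_xs aL) (L_xs2 aL) /= => yx xy; apply/idP/idP.
Qed.

Lemma ev_diff t k a x : x \in xs -> ev (wd t) k (diff a x) <->
  (a \in sigma x (pos t x k)) != (a \in sigma x (pos t x k.+1)).
Proof.
move=> xxs; rewrite /diff.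
have -> : ev (wd t) k (PNot (PIff (PAtom a x) (PNext (PAtom a x))))
  = ~ ev (wd t) k (PIff (PAtom a x) (PNext (PAtom a x))) by [].
rewrite ev_iff /= /tword xxs /=.
set b := _ \in _; set c := _ \in _; rewrite -/b -/c.
by case: b; case: c; split=> //; [case|move=> _ [/(_ isT)]|move=> _ [_ /(_ isT)]|case].
Qed.

Lemma ev_const t k a x : ftraj xs t -> x \in xs -> ev (wd t) k (const a x) <->
  forall p, pos t x k <= p -> (a \in sigma x p) = (a \in sigma x (pos t x k)).
Proof.
move=> ft xxs.
have evE : ev (wd t) k (const a x) <->
    (forall i, ev (wd t) (k + i) (PAtom a x)) \/
    (forall i, ev (wd t) (k + i) (PNot (PAtom a x))).
  have -> : ev (wd t) k (const a x) = (ev (wd t) k (PBox (PAtom a x)) \/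
    ev (wd t) k (PBox (PNot (PAtom a x)))) by [].
  by rewrite !ev_box.
rewrite {}evE /= /tword xxs /=; split=> [H p lep|H].
  have [l El] := pos_unbounded ft xxs p.
  have [lekl|ltlk] := leqP k l.
    rewrite -El -(subnKC lekl); case: H => H; move: (H 0) (H (l - k)); rewrite addn0.
      by move=> -> ->.
    by move=> /negP/negbTE-> /negP/negbTE->.
  suff -> : p = pos t x k by [].
  by apply/eqP; rewrite eqn_leq lep -El (pos_le t x (ltnW ltlk)).
have [ak|/negbTE ak] := boolP (a \in sigma x (pos t x k)); [left|right] => i;
  by rewrite H ?pos_le ?leq_addr // ak.
Qed.

(** * Counting the changes of a proposition *)

Fixpoint changes a x p : nat :=
  if p is q.+1
  then changes a x q + ((a \in sigma x q) != (a \in sigma x q.+1)) else 0.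

Lemma changes_le a x p q : p <= q -> changes a x p <= changes a x q.
Proof.
move=> /subnK <-; elim: (q - p) => // d IHd.
by rewrite addSn /= (leq_trans IHd) ?leq_addr.
Qed.

Lemma changes_step t a x k : changes a x (pos t x k.+1) = changes a x (pos t x k) +
  ((a \in sigma x (pos t x k)) != (a \in sigma x (pos t x k.+1))).
Proof. by rewrite /=; case: (t k x); rewrite ?addn1 ?addn0 ?eqxx ?addn0. Qed.

(** While [a] has equal values in [x] and [y], every step changes it in both or in neither. *)
Lemma changes_sync t n a x y : (a, x, y) \in L ->
  (forall k, k <= n -> in_phase_at (wd t) L k) ->
  forall k, k <= n -> changes a x (pos t x k) = changes a y (pos t y k).
Proof.
move=> aL inph; elim=> // k IHk ltk; rewrite !changes_step IHk 1?ltnW //.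
have /in_phase_eq/(_ _ _ _ aL)-> := inph _ (ltnW ltk).
by have /in_phase_eq/(_ _ _ _ aL)-> := inph _ ltk.
Qed.

(** Suppose [t'] is aligned, and consider the first step at which it carries a trace of [C] beyond
    its position in the deadlock reached by [t]. The obstruction to the set of traces passing at
    that step yields an [a] that has changed once more in [x] than it can have in [y], against
    [changes_sync]. *)
Lemma never_aligned_sound t t' : ftraj xs t -> ftraj xs t' ->
  ev (wd t) 0 (never_aligned xs L) -> ~ aligned xs sigma t' L.
Proof.
move=> ft ft' [nR|[T [/ev_and[]]]] //.
  by move=> al; apply/nR/ev_in_phase; apply: (al 0).
rewrite add0n => /ev_in_phase RT /ev_bigor[C].
rewrite mem_filter => /andP[C0 /mem_subs Cxs] /ev_bigand stC prefT al.
have inT k : k <= T -> in_phase_at (wd t) L k.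
  rewrite leq_eqVlt => /predU1P[->//|/prefT]; rewrite add0n.
  by move/ev_in_phase.
have stuckN (N : pred var) : has N C -> exists a x y,
    [/\ (a, x, y) \in L, x \in C, N x,
        (a \in sigma x (pos t x T)) != (a \in sigma x (pos t x T.+1)) &
        if (y \in C) && N y
        then (a \in sigma y (pos t y T)) = (a \in sigma y (pos t y T.+1))
        else y \in C \/ forall p, pos t y T <= p ->
              (a \in sigma y p) = (a \in sigma y (pos t y T))].
  move=> hasN; have /stC : filter N C \in [seq N <- subs C | N != [::]].
    by rewrite mem_filter filter_subs andbT -has_filter.
  move=> /ev_bigor[[[a x] y] aL]; rewrite /blocked !mem_filter.
  case: ifP => [/andP[Nx xC]|_ []//].
  move=> /ev_and[/(ev_diff _ _ _ (L_xs aL)) dx bl].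
  exists a, x, y; split=> //; rewrite andbC; case: ifP bl => [_ nd|_].
    apply/eqP; apply: contra_notT nd => nd; apply/(ev_diff _ _ _ (L_xs2 aL)).
    by rewrite nd.
  case: ifP => [yC _|_]; first by left.
  by move/(ev_const _ _ ft (L_xs2 aL)); right.
(* A letter of the word changes only if its trace moves. The singletons [N] thus force all of [C] to
   move at time [T], so that [diff] compares consecutive letters of each trace. *)
have moves x : x \in C -> t T x.
  move=> xC; have [|a [x' [y [_ _ /eqP-> dx _]]]] := stuckN (pred1 x).
    by apply/hasP; exists x => //=.
  by move: dx; rewrite /=; case: (t T x) => //; rewrite addn0 eqxx.
pose beyond k := has (fun x => pos t x T < pos t' x k) C.
have exb : exists k, beyond k.
  case: C C0 Cxs @beyond {stC stuckN moves} => // x C _ Cxs.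
  have xxs : x \in xs by apply: Cxs; rewrite mem_head.
  have [k Ek] := pos_unbounded ft' xxs (pos t x T).+1.
  by exists k; rewrite /= Ek ltnSn.
case: (ex_minnP exb) => -[/hasP[]//|k] bk mink.
have before x : x \in C -> pos t' x k <= pos t x T.
  move=> xC; rewrite leqNgt; apply/negP=> ltx.
  have : beyond k by apply/hasP; exists x.
  by move/mink; rewrite ltnn.
have first_move x : x \in C -> pos t x T < pos t' x k.+1 ->
    pos t' x k = pos t x T /\ pos t' x k.+1 = pos t x T.+1.
  move=> xC ltx; have le1 : pos t' x k.+1 <= (pos t' x k).+1.
    by rewrite /= -addn1 leq_add2l leq_b1.
  have E : pos t' x k = pos t x T.
    by apply/eqP; rewrite eqn_leq before //= -ltnS (leq_trans ltx).
  split=> //; rewrite [RHS]/= moves // addn1 -E; apply/eqP.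
  by rewrite eqn_leq le1 E ltx.
(* Here [N] consists of the traces that pass the deadlock at step [k] of [t']. *)
have [a [x [y [aL xC Nx dx dy]]]] := stuckN _ bk.
have [Ex1 Ex2] := first_move x xC Nx.
have sync' := changes_sync aL (fun l _ => al l) (leqnn k.+1).
have sync := changes_sync aL inT (leqnn T).
have E : changes a y (pos t' y k.+1) = (changes a y (pos t y T)).+1.
  by rewrite -sync' -sync Ex2 changes_step dx addn1.
(* The count for [y] cannot have grown: [y] passes without a change, or has not passed, or is
   constant from its deadlock position on. *)
move: dy; case: ifP => [/andP[yC Ny]|Ny].
  have [_ Ey2] := first_move y yC Ny.
  move=> dy; move: E; rewrite Ey2 changes_step dy eqxx addn0.
  by move/n_Sn.
case=> [yC|cst].
  move: Ny; rewrite yC /= => /negbT; rewrite -leqNgt => /(changes_le a y).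
  by rewrite E ltnn.
have noch d : changes a y (pos t y T + d) = changes a y (pos t y T).
  elim: d => [|d IHd]; rewrite ?addn0 // addnS /= IHd !cst ?eqxx ?addn0 //.
  by rewrite ltnW // ltnS leq_addr.
  by rewrite leq_addr.
have [ley|/ltnW/(changes_le a y)] := leqP (pos t y T) (pos t' y k.+1).
  by move: E; rewrite -(subnKC ley) noch => /n_Sn.
by rewrite E ltnn.
Qed.

(** ** Aligned configurations *)

Definition config := var -> nat.
Implicit Types (p q : config) (m : pred var).

Definition phase_ok p : Prop := forall a x y, (a, x, y) \in L ->
  (a \in sigma x (p x)) = (a \in sigma y (p y)).

Definition valid_move m : Prop := (exists x, m x) /\ forall x, m x -> x \in xs.

Definition move p m : config := fun x => p x + m x.

Inductive reach p : config -> Prop :=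
| Reach_refl : reach p p
| Reach_step q m : reach p q -> valid_move m -> phase_ok (move q m) ->
    reach p (move q m).

Lemma reach_trans p q r : reach p q -> reach q r -> reach p r.
Proof. by move=> pq; elim=> // *; apply: Reach_step. Qed.

Lemma reach_ok p q : phase_ok p -> reach p q -> phase_ok q.
Proof. by move=> okp; case. Qed.

Definition frozen p x : Prop := forall q, reach p q -> q x = p x.

Lemma frozen_mono p q x : reach p q -> frozen p x -> frozen q x.
Proof.
move=> pq fr r qr; rewrite (fr q pq).
exact/fr/(reach_trans pq).
Qed.

(** A frozen trace remains frozen, so the number of traces that are not frozen only decreases along
    [reach]; the configuration is one where it can decrease no further. *)
Lemma reach_max p : exists2 q, reach p q &
  forall r x, reach q r -> x \in xs -> frozen r x -> frozen q x.
Proof.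
pose nf q := count (fun x => ~~ `[< frozen q x >]) xs.
elim: {p}(nf p) {-2}p (leqnn (nf p)) => [|n IHn] p lep.
  exists p; first exact: Reach_refl.
  move=> r x _ xxs _; apply: contrapT => nfx; move: lep.
  by rewrite leqNgt -has_count => /hasPn/(_ x xxs)/negPn/asboolP.
have [|nmax] := pselect (forall r x, reach p r -> x \in xs -> frozen r x -> frozen p x).
  by exists p => //; apply: Reach_refl.
have [r [x [pr xxs rx px]]] : exists r x, [/\ reach p r, x \in xs, frozen r x & ~ frozen p x].
  apply: contrapT => H; apply: nmax => r x pr xxs rx; apply: contrapT => px.
  by apply: H; exists r, x.
have [|q rq maxq] := IHn r; last by exists q => //; apply: reach_trans rq.
rewrite -ltnS (leq_trans _ lep) // /nf.
have sub y : ~~ `[< frozen r y >] -> ~~ `[< frozen p y >].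
  by apply: contra => /asboolP py; apply/asboolP/(frozen_mono pr).
elim: xs xxs => // z s IHs; rewrite inE => /predU1P[<-|/IHs lts] /=.
  rewrite asboolT //= add0n asboolF //= add1n ltnS.
  exact: sub_count.
by rewrite -addnS leq_add //; have := sub z; case: asbool; case: asbool => // /(_ isT).
Qed.

Lemma reach_traj p : reach (fun=> 0) p -> phase_ok (fun=> 0) ->
  exists n (t : trajectory), [/\ forall k, k < n -> valid_move (t k),
    forall k, k <= n -> phase_ok (pos t ^~ k) & forall x, pos t x n = p x].
Proof.
move=> rp ok0; elim: rp => [|q m _ [n [t [tv tok tq]]] mv okm].
  by exists 0, (fun=> xpredT); split=> // k; rewrite leqn0 => /eqP->.
pose t' k := if k < n then t k else m.
have posE x k : k <= n -> pos t' x k = pos t x k.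
  by elim: k => // k IHk ltk; rewrite /= IHk 1?ltnW // /t' ltk.
have posn x : pos t' x n.+1 = move q m x.
  by rewrite /= posE // tq /t' ltnn.
exists n.+1, t'; split=> // k.
  by rewrite /t'; case: (k < n) / idP => // /tv.
rewrite leq_eqVlt => /predU1P[-> a x y aL|]; first by rewrite !posn; apply: okm.
by rewrite ltnS => lek a x y aL; rewrite !posE //; apply: (tok k).
Qed.

Definition cat_traj n t1 t2 : trajectory :=
  fun j => if j < n then t1 j else t2 (j - n).

Lemma pos_cat_le n t1 t2 x k :
  k <= n -> pos (cat_traj n t1 t2) x k = pos t1 x k.
Proof.
by elim: k => // k IHk ltk; rewrite /= IHk 1?ltnW // /cat_traj ltk.
Qed.

Lemma pos_cat n t1 t2 x k :
  pos (cat_traj n t1 t2) x (n + k) = pos t1 x n + pos t2 x k.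
Proof.
elim: k => [|k IHk]; first by rewrite !addn0 pos_cat_le.
by rewrite addnS /= IHk /cat_traj ltnNge leq_addr /= addKn addnA.
Qed.

Lemma ftraj_cat n t1 t2 :
  (forall k, k < n -> valid_move (t1 k)) -> ftraj xs t2 ->
  ftraj xs (cat_traj n t1 t2).
Proof.
move=> v1 [v2 f2]; split=> [j|x xxs i].
  by rewrite /cat_traj; case: ltnP => [/v1|_]; [|apply: v2].
have [j lej tj] := f2 x xxs i; exists (n + j).
  by rewrite (leq_trans lej) ?leq_addl.
by rewrite /cat_traj ltnNge leq_addr addKn.
Qed.

Lemma valid_all : xs != [::] -> valid_move (mem xs).
Proof.
rewrite /valid_move; case: (xs) => // x s _.
by split=> [|y //]; exists x; rewrite /= mem_head.
Qed.

Lemma ftraj_all : xs != [::] -> ftraj xs (fun=> mem xs).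
Proof.
by move=> /valid_all v; split=> [//|x xxs i]; exists i.
Qed.

(** Storing in each vertex the move that led to it turns the motion of a trace into a property of
    vertices, the form in which [round_robin] takes its targets. *)
Definition conf_step (s s' : config * pred var) : Prop :=
  [/\ valid_move s'.2, s'.1 = move s.1 s'.2 & phase_ok s'.1].

Lemma reach_pathn p m0 q r : reach p q -> reach q r ->
  r = q \/
  exists n m, pathn conf_step (fun s => reach p s.1) n (q, m0) (r, m).
Proof.
move=> pq; elim=> [|{}r m qr IHr mv okm]; first by left.
right; case: IHr => [rq|[n [m' pth]]].
  by exists 0, m; split; rewrite //= rq.
exists n.+1, m; apply: pathn_rcons pth _ _ => //=.
exact: reach_trans qr.
Qed.

Lemma reach_moves p m0 q r x : reach p q -> reach q r -> r x != q x ->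
  exists n s, [/\ reach p s.1, s.2 x : bool &
    pathn conf_step (fun s => reach p s.1) n (q, m0) s].
Proof.
move=> pq; elim=> [|{}r m qr IHr mv okm]; first by rewrite eqxx.
have [rx|/IHr//] := eqVneq (r x) (q x).
case mx: (m x); last by rewrite /move mx addn0 rx eqxx.
move=> _; have pr := reach_trans pq qr.
have pm : reach p (move r m) by apply: Reach_step.
have [rq|[n [m' pth]]] := reach_pathn m0 pq qr.
  by exists 0, (move r m, m); split=> //; split; rewrite //= rq.
by exists n.+1, (move r m, m); split=> //; apply: pathn_rcons pth _ _.
Qed.

(** If no trace is ever frozen from [p] on, each can be made to move again from every reachable
    configuration. Serving them in turn on the infinite graph of aligned configurations gives
    fairness. *)
Lemma aligned_exists p : xs != [::] -> phase_ok (fun=> 0) ->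
  reach (fun=> 0) p ->
  (forall q x, reach p q -> x \in xs -> ~ frozen q x) ->
  exists2 t, ftraj xs t & aligned xs sigma t L.
Proof.
move=> xs0 ok0 rp nfr.
pose F j (s : config * pred var) : Prop := s.2 (nth 0 xs j).
have Jgt : 0 < size xs by case: (xs) xs0.
have prog : forall w j, reach p w.1 -> j < size xs ->
    exists n v, [/\ reach p v.1, F j v & pathn conf_step (fun s => reach p s.1) n w v].
  move=> [q m0] j pq ltj; have xxs := mem_nth 0 ltj.
  have /existsNP[r /not_implyP[qr /eqP rx]] := nfr q _ pq xxs.
  by have [n [s [ps sx pth]]] := reach_moves m0 pq qr rx; exists n, s.
have [rho [rho0 rhoW rhoE rhoF]] :=
  @round_robin _ _ (fun s => reach p s.1) F _ Jgt prog (p, xpred0) (Reach_refl p).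
have [n [t1 [v1 ok1 pos1]]] := reach_traj rp ok0.
(* The move made at step [k] is stored in the vertex it leads to. *)
pose t2 k := (rho k.+1).2.
have pos2 x k : p x + pos t2 x k = (rho k).1 x.
  elim: k => [|k IHk]; first by rewrite addn0 rho0.
  by rewrite /= addnA IHk; have [_ -> _] := rhoE k.
have ft2 : ftraj xs t2.
  split=> [k|x xxs i]; first by have [] := rhoE k.
  have [|[|l] // ltil] := rhoF (index x xs) i; first by rewrite index_mem.
  by rewrite /F nth_index // => rx; exists l.
exists (cat_traj n t1 t2); first exact: ftraj_cat.
move=> k; apply/in_phase_eq => a x y aL.
have [lekn|/ltnW/subnKC<-] := leqP k n.
  by rewrite !pos_cat_le //; apply: (ok1 k).
rewrite !pos_cat !pos1 !pos2.
exact: (reach_ok (reach_ok ok0 rp) (rhoW _)).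
Qed.

Lemma reach_next p q y : reach p q -> q y != p y ->
  exists2 r, reach p r & r y = (p y).+1.
Proof.
elim=> [|{}q m pq IHq mv okm]; first by rewrite eqxx.
have [qy|/IHq//] := eqVneq (q y) (p y).
case my: (m y); last by rewrite /move my addn0 qy eqxx.
move=> _; exists (move q m); first exact: Reach_step.
by rewrite /move my qy addn1.
Qed.

(** The deadlock is the set of frozen traces at a configuration where this set is maximal.
    Maximality keeps every other trace movable for ever, and this is what makes its compared
    propositions constant. *)
Lemma never_aligned_complete : xs != [::] ->
  (forall t, ftraj xs t -> ~ aligned xs sigma t L) ->
  exists2 t, ftraj xs t & ev (wd t) 0 (never_aligned xs L).
Proof.
move=> xs0 nal.
have [ok0|nok0] := pselect (phase_ok (fun=> 0)); last first.
  exists (fun=> mem xs); first exact: ftraj_all.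
  by left=> /ev_in_phase/in_phase_eq.
have [p rp maxp] := reach_max (fun=> 0).
pose C := [seq x <- xs | `[< frozen p x >]].
have C0 : C != [::].
  apply/negP=> /eqP CE.
  have [|t ft /(nal t ft)//] := aligned_exists xs0 ok0 rp.
  move=> q x pq xxs /(maxp _ _ pq xxs) px.
  by have : x \in C; [rewrite mem_filter asboolT|rewrite CE].
have [n [t1 [v1 ok1 pos1]]] := reach_traj rp ok0.
(* Beyond the prefix all traces move at every step, so that [diff] at time [n] sees the next letter
   of each of them. *)
pose t := cat_traj n t1 (fun=> mem xs).
have ft : ftraj xs t by apply/ftraj_cat/ftraj_all.
have posn x : pos t x n = p x by rewrite pos_cat_le.
have posn1 x : x \in xs -> pos t x n.+1 = (p x).+1.
  by move=> xxs; rewrite -addn1 pos_cat /= xxs pos1 addn1.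
have phn k : k <= n -> ev (wd t) k (in_phase L).
  move=> lek; apply/ev_in_phase/in_phase_eq => a x y aL.
  by rewrite !pos_cat_le //; apply: (ok1 k).
exists t => //; right; exists n; rewrite add0n; split; last first.
  by move=> j /ltnW/phn.
apply/ev_and; split; first exact: phn.
apply/ev_bigor; exists C; first by rewrite mem_filter C0 filter_subs.
apply/ev_bigand => N; rewrite mem_filter => /andP[N0 /mem_subs NC].
have Nxs x : x \in N -> x \in xs by move/NC; rewrite mem_filter => /andP[].
have Nfr x : x \in N -> frozen p x.
  by move/NC; rewrite mem_filter => /andP[/asboolP].
have vN : valid_move (mem N).
  by split=> //; case: (N) N0 => // x N' _; exists x; rewrite /= mem_head.
have okp := reach_ok ok0 rp.
(* A move of [N] that stays in phase would advance frozen traces. *)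
have nokN : ~ phase_ok (move p (mem N)).
  move=> okN; case: vN (vN) => -[x Nx] _ vN.
  have := Nfr x Nx _ (Reach_step (Reach_refl p) vN okN).
  by rewrite /move Nx addn1 => /esym/n_Sn.
pose ch a x := (a \in sigma x (p x)) != (a \in sigma x (p x).+1).
have [a [x [y [aL Nx dx dy]]]] : exists a x y,
    [/\ (a, x, y) \in L, x \in N, ch a x & y \in N -> ~~ ch a y].
  apply: contrapT => H; apply: nokN => a x y aL.
  have H' u v : (a, u, v) \in L -> (u \in N) && ch a u -> (v \in N) && ch a v.
    move=> uvL /andP[Nu du]; apply: contrapT => nv; apply: H.
    exists a, u, v; split=> // Nv; apply/negP => dv; apply: nv.
    by rewrite Nv.
  have valE u : (a \in sigma u (move p (mem N) u)) =
      (a \in sigma u (p u)) (+) ((u \in N) && ch a u).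
    rewrite /move /ch /=; case: (u \in N); rewrite ?addn0 ?addbF //= addn1.
    by case: (a \in _); case: (a \in _).
  rewrite !valE (okp _ _ _ aL); congr addb.
  by apply/idP/idP; [apply: H'|apply: H'; apply: L_sym].
apply/ev_bigor; exists (a, x, y) => //; rewrite /blocked Nx.
have xxs := Nxs _ Nx; have yxs := L_xs2 aL.
apply/ev_and; split; first by apply/ev_diff; rewrite // posn posn1.
case: ifP => [/dy ndy|_].
  by move=> /(ev_diff _ _ _ yxs); rewrite posn posn1 //; apply/negP.
case: ifP => // yC; apply/ev_const => // q; rewrite posn => leq.
have nfy r : reach p r -> ~ frozen r y.
  move=> pr /(maxp _ _ pr yxs) py.
  by move: yC; rewrite mem_filter asboolT // yxs.
have [r pr <-] : exists2 r, reach p r & r y = q.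
  rewrite -(subnKC leq); elim: (q - p y) => [|d [r pr ry]].
    by exists p; rewrite ?addn0 //; apply: Reach_refl.
  have /existsNP[r' /not_implyP[rr' /eqP r'y]] := nfy r pr.
  have [u ru uy] := reach_next rr' r'y.
  by exists u; [apply: reach_trans ru|rewrite uy ry addnS].
by rewrite -(okp _ _ _ aL) -(reach_ok okp pr aL) (Nfr _ Nx).
Qed.

Lemma pos_pred1 x y k : pos (fun=> pred1 x) y k = if y == x then k else 0.
Proof.
elim: k => [|k /= ->] /=; first by case: eqP.
by case: eqP => //; rewrite addn1.
Qed.

(** Trajectories can bring any position of [x] together with any position of [y], since [x] and [y]
    differ: advance [x] alone, next [y] alone, and continue fairly. An implication is safe only if
    its premise never holds or its conclusion always does. *)
Lemma ev_always_in_phase t : ftraj xs t ->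
  ev (wd t) 0 (always_in_phase L) <->
  forall t', ftraj xs t' -> aligned xs sigma t' L.
Proof.
move=> ft; rewrite ev_bigand; split=> [H t' ft' k [[a x] y] aL|H [[a x] y] aL].
  have [xxs yxs] := (L_xs aL, L_xs2 aL).
  rewrite /tword xxs yxs /= => ax.
  have : ev (wd t) 0 (PBox (PNot (PAtom a x))) \/ ev (wd t) 0 (PBox (PAtom a y)).
    exact: H aL.
  case=> /ev_box /= Hi.
    have [i Ei] := pos_unbounded ft xxs (pos t' x k).
    by have := Hi i; rewrite add0n /tword xxs Ei /= ax.
  have [i Ei] := pos_unbounded ft yxs (pos t' y k).
  by have := Hi i; rewrite add0n /tword yxs Ei.
have [xxs yxs] := (L_xs aL, L_xs2 aL).
apply: contrapT => nor.
have /not_orP[nx ny] : ~ (ev (wd t) 0 (PBox (PNot (PAtom a x))) \/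
  ev (wd t) 0 (PBox (PAtom a y))) by [].
have [i ax] : exists i, a \in sigma x i.
  apply: contrapT => nex; apply: nx; apply/ev_box => l /=.
  by rewrite /tword xxs => ai; apply: nex; eexists; apply: ai.
have [j ay] : exists j, a \notin sigma y j.
  apply: contrapT => nex; apply: ny; apply/ev_box => l /=.
  rewrite /tword yxs /=; apply: contrapT => /negP ai; apply: nex.
  by eexists; apply: ai.
have xs0 : xs != [::] by case: (xs) xxs.
pose t' := cat_traj i (fun=> pred1 x) (cat_traj j (fun=> pred1 y) (fun=> mem xs)).
have ft' : ftraj xs t'.
  apply: ftraj_cat => [k _|]; first by split; [exists x; rewrite /= eqxx|move=> z /eqP->].
  apply: ftraj_cat => [k _|]; first by split; [exists y; rewrite /= eqxx|move=> z /eqP->].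
  exact: ftraj_all.
have := H t' ft' (i + (j + 0)) _ aL.
have /eqP nxy := L_neq aL.
rewrite /tword xxs yxs /= !pos_cat !pos_pred1 !eqxx (negbTE nxy) eq_sym (negbTE nxy) /=.
by rewrite !addn0 add0n ax (negbTE ay) => /(_ isT).
Qed.

End Alignment.

(** The disjuncts of [forall_traj] answer to the cases: both kinds of trajectories exist, all are
    aligned, none is. The substituted bodies do not depend on the trajectory, so the one trajectory
    granted by [E] is free to exhibit the deadlock. *)
Lemma forall_trajP (AP : finType) (xs : seq var) (sigma : var -> trace AP) f :
  bool_comb (@phase_or_co AP) 1 true f -> {subset pvars f <= xs} -> xs != [::] ->
  (forall t, ftraj xs t -> ev (tword xs sigma t) 0 f) <->
  exists2 t, ftraj xs t & ev (tword xs sigma t) 0 (forall_traj xs f).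
Proof.
move=> cf fxs xs0; set L := phase_triples f.
have [_ /(_ erefl)[L_sym e0 e1 ind]] := bool_comb_phase xs sigma cf.
have L_neq a x y : (a, x, y) \in L -> x <> y by case/phase_triplesP.
have L_xs a x y : (a, x, y) \in L -> x \in xs by case/phase_triplesP => _ /fxs.
rewrite -/L in L_sym e0 e1.
pose al t := aligned xs sigma t L.
have fta := ftraj_all xs0; split=> [H|[t ft]].
  have [[t1 ft1 al1]|nal] := pselect (exists2 t, ftraj xs t & al t).
    have s0 t : ftraj xs t -> ev (tword xs sigma t) 0 (subst_phase false f).
      move=> ft; apply: (ind _ _ _ ft1 ft); apply/(e0 _ al1); exact: H.
    have [[t2 ft2 nal2]|aal] := pselect (exists2 t, ftraj xs t & ~ al t).
      exists t1 => //; left; apply/ev_and; split; first exact: s0.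
      by apply: (ind _ _ _ ft2 ft1); apply/(e1 _ nal2)/H.
    exists t1 => //; right; left; apply/ev_and; split; first exact: s0.
    apply/ev_always_in_phase => // t ft; apply: contrapT => nalt.
    by apply: aal; exists t.
  have [|t ft nt] := @never_aligned_complete _ _ sigma _ L_sym L_xs xs0.
    by move=> t ft alt; apply: nal; exists t.
  exists t => //; right; right; apply/ev_and; split=> //.
  by apply/e1; [move=> alt; apply: nal; exists t|apply: H].
move=> E t' ft'.
have key b : ev (tword xs sigma t) 0 (subst_phase b f) ->
             ev (tword xs sigma t') 0 (subst_phase b f) by apply: ind.
case/ev_or: E => [/ev_and[/key s0 /key s1]|/ev_or[/ev_and[/key s0 aal]|/ev_and[/key s1 nal]]].
- by have [/e0 ->|/e1 ->] := pselect (al t').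
- apply/e0 => //; move: aal; rewrite (@ev_always_in_phase _ _ sigma _ L_sym L_neq L_xs) //.
  exact.
- by apply/e1 => //; apply: (never_aligned_sound L_sym L_xs ft ft').
Qed.

(** * Certificates for fair paths in finite graphs *)

Lemma testbitS n i : testbit n i.+1 = testbit n./2 i.
Proof. by rewrite /testbit expnS divnMA divn2. Qed.

Lemma testbit_exists (P : pred nat) N :
  exists2 U, U < 2 ^ N & forall i, i < N -> testbit U i = P i.
Proof.
elim: N P => [|N IHN] P; first by exists 0.
have [U ltU UP] := IHN (fun i => P i.+1); exists (P 0 + U.*2).
  rewrite expnS mul2n; apply: (@leq_trans U.*2.+2); last by rewrite -doubleS leq_double.
  by rewrite ltnS -add1n leq_add2r leq_b1.
case=> [_|i]; last by rewrite testbitS half_bit_double; apply: UP.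
by rewrite /testbit divn1 oddD odd_double addbF oddb.
Qed.

Section FairCert.
Variables (NB J : nat) (I : pred nat) (E : rel nat) (F : nat -> pred nat).

(** Reachability is expressed without paths, by its least fixed point: every [U] that contains the
    successors of [w] in [W] and is closed under edges into [W] meets the target. All quantifiers
    then range over numbers below explicit bounds. *)
Definition fair_cert : bool :=
  has (fun W => has (fun v => testbit W v && I v) (iota 0 NB) &&
    all (fun w => testbit W w ==> all (fun j => all (fun U =>
        all (fun b => testbit W b && E w b ==> testbit U b) (iota 0 NB) &&
        all (fun a => all (fun b =>
          testbit U a && testbit W b && E a b ==> testbit U b)
          (iota 0 NB)) (iota 0 NB)
        ==> has (fun y => testbit U y && F j y) (iota 0 NB))
      (iota 0 (2 ^ NB))) (iota 0 J)) (iota 0 NB)) (iota 0 (2 ^ NB)).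

Lemma allP_iota n (P : pred nat) :
  reflect (forall i, i < n -> P i) (all P (iota 0 n)).
Proof.
by apply: (iffP allP) => H i; have := H i; rewrite mem_iota.
Qed.

Lemma hasP_iota n (P : pred nat) :
  reflect (exists2 i, i < n & P i) (has P (iota 0 n)).
Proof.
by apply: (iffP hasP) => -[i]; [rewrite mem_iota|move=> ltin]; exists i;
   rewrite ?mem_iota.
Qed.

Lemma fair_certP : 0 < J ->
  fair_cert <-> exists rho : nat -> nat,
    [/\ forall k, rho k < NB, I (rho 0), forall k, E (rho k) (rho k.+1) &
        forall j k, j < J -> exists2 l, k < l & F j (rho l)].
Proof.
move=> J0; split=> [/hasP_iota[W _ /andP[/hasP_iota[v ltv /andP[Wv Iv]] /allP_iota H]]|].
  pose V b := b < NB /\ testbit W b.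
  have [|rho [rho0 rhoW rhoE rhoF]] :=
      @round_robin _ E V F _ J0 _ v (conj ltv Wv); last first.
    by exists rho; split=> // [k|]; [have [] := rhoW k|rewrite rho0].
  move=> w j [ltw Ww] ltj.
  (* The closed set to which the certificate is applied is the set of nodes that are reachable
     inside [W]. *)
  have [U ltU UP] := testbit_exists
    (fun b => `[< V b /\ exists n, pathn E V n w b >]) NB.
  have := H w ltw; rewrite Ww => /allP_iota/(_ j ltj)/allP_iota/(_ U ltU).
  move=> /implyP HU.
  have /HU/hasP_iota[y lty] : all (fun b => testbit W b && E w b ==> testbit U b)
      (iota 0 NB) && all (fun a => all (fun b =>
        testbit U a && testbit W b && E a b ==> testbit U b) (iota 0 NB)) (iota 0 NB).
    apply/andP; split.
      apply/allP_iota => b ltb; apply/implyP => /andP[Wb wb]; rewrite UP //.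
      by apply/asboolP; split=> //; exists 0.
    apply/allP_iota => a lta; apply/allP_iota => b ltb; apply/implyP.
    rewrite !UP // => /andP[/andP[/asboolP[Va [n wa]] Wb] ab].
    by apply/asboolP; split=> //; exists n.+1; apply: pathn_rcons wa _ _.
  rewrite UP // => /andP[/asboolP[Vy [n wy]] Fy].
  by exists n, y.
move=> [rho [ltrho I0 rhoE rhoF]].
(* All visited nodes may serve as [W]: from any visit the rest of the path stays in [W] and meets
   every target again. *)
have [W ltW WP] := testbit_exists (fun b => `[< exists k, rho k = b >]) NB.
apply/hasP_iota; exists W => //; apply/andP; split.
  apply/hasP_iota; exists (rho 0); rewrite // WP // I0 andbT.
  by apply/asboolP; exists 0.
apply/allP_iota => w ltw; rewrite WP //; apply/implyP => /asboolP[k Ek].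
apply/allP_iota => j ltj; apply/allP_iota => U _; apply/implyP.
move=> /andP[/allP_iota H1 /allP_iota H2].
have inW l : testbit W (rho l) by rewrite WP //; apply/asboolP; exists l.
have inU d : testbit U (rho (k.+1 + d)).
  elim: d => [|d IHd].
    by have /implyP := H1 _ (ltrho (k.+1 + 0)); apply; rewrite inW addn0 -Ek rhoE.
  have /allP_iota/(_ _ (ltrho (k.+1 + d.+1)))/implyP := H2 _ (ltrho (k.+1 + d)).
  by apply; rewrite IHd inW addnS rhoE.
have [l ltkl Fl] := rhoF j k ltj.
by apply/hasP_iota; exists (rho l) => //; rewrite Fl -(subnKC ltkl) inU.
Qed.

End FairCert.

(** * The tableau of a Kripke structure and a path formula *)

(** Tags up to 1 stop the recursion, because the components of an atom are not codes of formulas. *)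
Definition nsubs : nat -> nat := nfold (fun c r s =>
  code (if fld c 0 <= 1 then [:: c]
        else if (fld c 0 == 3) || (fld c 0 == 4) then c :: (decode r ++ decode s)
        else c :: decode r)).

Section Tableau.
Variables (K X phi : nat).

Definition nstates : nat := size (decode K).
Definition ninit (s : nat) : bool := fld (fld K s) 0 == 1.
Definition ntrans (s s' : nat) : bool := s' \in decode (fld (fld K s) 1).
Definition nlabel (s a : nat) : bool := a \in decode (fld (fld K s) 2).

(* A node is a bit mask: bit [3 x] tells whether trace [x] moves, bit [3 c + 1]
   whether the formula with code [c] holds, and bit [3 (x m + s) + 2], where
   [m] is the number of states, whether trace [x] is in state [s]. *)
Definition node_moves (v x : nat) : bool := testbit v (3 * x).
Definition node_holds (v c : nat) : bool := testbit v (3 * c + 1).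
Definition node_state (v x : nat) : nat :=
  find (fun s => testbit v (3 * (x * nstates + s) + 2)) (iota 0 nstates).

Definition node_local (v v' c : nat) : bool :=
  if fld c 0 == 0 then node_holds v c
  else if fld c 0 == 1 then
    node_holds v c == ((fld c 2 \in decode X) &&
                       nlabel (node_state v (fld c 2)) (fld c 1))
  else if fld c 0 == 2 then node_holds v c == ~~ node_holds v (fld c 1)
  else if fld c 0 == 3 then
    node_holds v c == (node_holds v (fld c 1) || node_holds v (fld c 2))
  else if fld c 0 == 4 then
    node_holds v c == (node_holds v (fld c 2) ||
                       (node_holds v (fld c 1) && node_holds v' c))
  else node_holds v c == node_holds v' (fld c 1).

Definition node_edge (v v' : nat) : bool :=
  all (fun x => (node_state v x < nstates) && (node_state v' x < nstates) &&
         (if node_moves v x then ntrans (node_state v x) (node_state v' x)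
          else node_state v' x == node_state v x)) (decode X)
  && has (fun x => node_moves v x) (decode X)
  && all (fun c => node_local v v' c) (decode (nsubs phi)).

Definition node_init (v : nat) : bool :=
  node_holds v phi && all (fun x => ninit (node_state v x)) (decode X).

(** A generalized Buchi condition: the first indices ask each trace to move infinitely often, the
    remaining ones forbid an until to be postponed for ever. *)
Definition node_fair (j v : nat) : bool :=
  if j < size (decode X) then node_moves v (fld X j)
  else (fld (fld (nsubs phi) (j - size (decode X))) 0 == 4) ==>
       node_holds v (fld (nsubs phi) (j - size (decode X))) ==>
       node_holds v (fld (fld (nsubs phi) (j - size (decode X))) 2).

(** An upper bound for the three kinds of bit positions; sums stand in for maxima, as a list member
    is at most the sum of its list. *)
Definition node_bits : nat :=
  3 * (sumn (decode X) + sumn (decode (nsubs phi)) +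
       (sumn (decode X)).+1 * nstates) + 3.

Definition exists_fair_path : bool :=
  fair_cert (2 ^ node_bits) (size (decode X) + size (decode (nsubs phi)))
    node_init node_edge node_fair.

End Tableau.

Lemma ev_until (AP : finType) (w : word AP) k f g : ev w k (PUntil f g) <->
  ev w k g \/ (ev w k f /\ ev w k.+1 (PUntil f g)).
Proof.
split=> [[[|i] [gi fj]]|[gk|[fk [i [gi fj]]]]].
- by left; rewrite addn0 in gi.
- right; split; first by have := fj 0 isT; rewrite addn0.
  by exists i; split=> [|j ltj]; rewrite addSnnS //; apply: fj.
- by exists 0; rewrite addn0.
- exists i.+1; rewrite -addSnnS; split=> // -[|j] ltj; first by rewrite addn0.
  by rewrite -addSnnS; apply: fj.
Qed.

Section TableauCorrect.
Variable AP : finType.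
Implicit Types (f g : pformula AP) (xs : seq var).

Fixpoint subfs f : seq (pformula AP) :=
  f :: match f with
       | PTrue | PAtom _ _ => [::]
       | PNot f | PNext f => subfs f
       | POr f g | PUntil f g => subfs f ++ subfs g
       end.

Lemma code_pformula_gt0 f : 0 < code_pformula f.
Proof. by case: f => *; rewrite /= muln_gt0 expn_gt0. Qed.

Lemma fld_code s j : fld (code s) j = nth 0 s j.
Proof. by rewrite /fld codeK. Qed.

Lemma decode_pformula f : decode (code_pformula f) =
  match f with
  | PTrue => [:: 0]
  | PAtom a x => [:: 1; code_elt a; x]
  | PNot f => [:: 2; code_pformula f]
  | POr f g => [:: 3; code_pformula f; code_pformula g]
  | PUntil f g => [:: 4; code_pformula f; code_pformula g]
  | PNext f => [:: 5; code_pformula f]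
  end.
Proof. by case: f => *; rewrite -[RHS]codeK. Qed.

Lemma code_elt_inj (T : finType) : injective (@code_elt T).
Proof. by move=> x y /val_inj/enum_rank_inj. Qed.

Lemma code_pformula_inj : injective (@code_pformula AP).
Proof.
move=> f g /(congr1 decode); elim: f g => [|a x|f IHf|f IHf g IHg|f IHf g IHg|f IHf];
  case=> [|b y|f'|f' g'|f' g'|f']; rewrite !decode_pformula // => -[] //.
- by move=> /code_elt_inj-> ->.
- by move=> /(congr1 decode)/IHf->.
- by move=> /(congr1 decode)/IHf-> /(congr1 decode)/IHg->.
- by move=> /(congr1 decode)/IHf-> /(congr1 decode)/IHg->.
- by move=> /(congr1 decode)/IHf->.
Qed.

Definition subcodes f : seq nat := map (@code_pformula AP) (subfs f).

Lemma subcodesE f : subcodes f = code_pformula f ::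
  match f with
  | PTrue | PAtom _ _ => [::]
  | PNot f | PNext f => subcodes f
  | POr f g | PUntil f g => subcodes f ++ subcodes g
  end.
Proof. by rewrite /subcodes; case: f => * /=; rewrite ?map_cat. Qed.

Lemma subcodes_refl f : code_pformula f \in subcodes f.
Proof. by rewrite subcodesE mem_head. Qed.

Lemma subcodesP f c : c \in subcodes f -> exists g, c = code_pformula g.
Proof.
rewrite /subcodes; elim: (subfs f) => //= g s IHs.
by rewrite inE => /predU1P[->|/IHs//]; exists g.
Qed.

Lemma subcodes_trans f g :
  code_pformula f \in subcodes g -> {subset subcodes f <= subcodes g}.
Proof.
elim: g => [|a x|g IHg|g IHg h IHh|g IHg h IHh|g IHg];
  rewrite subcodesE in_cons => /predU1P[/code_pformula_inj->|];
  try (by rewrite subcodesE); rewrite ?mem_cat // => fg c cf; rewrite in_cons ?mem_cat.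
- by rewrite (IHg fg) ?orbT.
- by case/orP: fg => [/IHg fg|/IHh fg]; rewrite (fg _ cf) ?orbT.
- by case/orP: fg => [/IHg fg|/IHh fg]; rewrite (fg _ cf) ?orbT.
- by rewrite (IHg fg) ?orbT.
Qed.

Lemma nsubsE f : decode (nsubs (code_pformula f)) = subcodes f.
Proof.
rewrite /nsubs /subcodes; elim: f => [|a x|f IHf|f IHf g IHg|f IHf g IHg|f IHf];
  by rewrite nfoldE ?code_pformula_gt0 // !fld_code codeK //= ?IHf ?IHg ?map_cat.
Qed.

Variable K : kripke AP.
Local Notation nK := (code_kripke K).

Lemma nstatesE : nstates nK = #|state K|.
Proof. by rewrite /nstates codeK size_map cardE. Qed.

Lemma fld_kripke (q : state K) : fld nK (enum_rank q) =
  code [:: nat_of_bool (q \in init K); code_set (trans q); code_set (mem (label q))].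
Proof.
rewrite /fld codeK (nth_map q) ?nth_enum_rank //.
by rewrite -cardE ltn_ord.
Qed.

Lemma mem_code_set (T : finType) (A : pred T) x :
  (code_elt x \in decode (code_set A)) = A x.
Proof.
by rewrite codeK mem_map ?mem_enum //; apply: code_elt_inj.
Qed.

Lemma ninitE (q : state K) : ninit nK (enum_rank q) = (q \in init K).
Proof. by rewrite /ninit fld_kripke fld_code /=; case: (q \in _). Qed.

Lemma ntransE (q q' : state K) :
  ntrans nK (enum_rank q) (enum_rank q') = trans q q'.
Proof. by rewrite /ntrans fld_kripke fld_code -mem_code_set. Qed.

Lemma nlabelE (q : state K) (a : AP) :
  nlabel nK (enum_rank q) (code_elt a) = (a \in label q).
Proof. by rewrite /nlabel fld_kripke fld_code /= mem_code_set. Qed.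

Lemma leq_sumn s x : x \in s -> x <= sumn s.
Proof.
elim: s => //= y s IHs; rewrite inE => /predU1P[->|/IHs]; first exact: leq_addr.
by move/leq_trans; apply; apply: leq_addl.
Qed.

Variables (xs : seq var) (phi : pformula AP).
Local Notation X := (code xs).
Local Notation nphi := (code_pformula phi).

Lemma bits_moves x : x \in xs -> 3 * x < node_bits nK X nphi.
Proof.
move=> /leq_sumn lex; rewrite /node_bits codeK addn3 !ltnS.
rewrite leqW // leqW // leq_mul2l /= -addnA (leq_trans lex) ?leq_addr //.
Qed.

Lemma bits_holds c : c \in decode (nsubs nphi) -> 3 * c + 1 < node_bits nK X nphi.
Proof.
move=> /leq_sumn lex; rewrite /node_bits codeK addn1 addn3 !ltnS leqW //.
by rewrite leq_mul2l /= addnAC (leq_trans lex) ?leq_addl.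
Qed.

Lemma bits_state x s : x \in xs -> s < #|state K| ->
  3 * (x * #|state K| + s) + 2 < node_bits nK X nphi.
Proof.
move=> /leq_sumn lex lts; rewrite /node_bits nstatesE codeK addn2 addn3 !ltnS.
rewrite leq_mul2l /= (leq_trans _ (leq_addl _ _)) // mulSn addnC.
by rewrite leq_add ?leq_mul2r ?lex ?orbT // ltnW.
Qed.

Lemma exists_fair_path_complete sigma t :
  {in xs, forall x, is_trace K (sigma x)} -> ftraj xs t ->
  ev (tword xs sigma t) 0 phi -> exists_fair_path nK X nphi.
Proof.
move=> sg_tr ft ev0; have [vt fr] := ft.
(* The option type provides values for variables outside [xs] even if [K] has no state. *)
have [st stP] : exists st : var -> nat -> option (state K), {in xs, forall x,
    exists rho, [/\ forall p, st x p = Some (rho p), rho 0 \in init K,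
      forall i, trans (rho i) (rho i.+1) & forall i, sigma x i = label (rho i)]}.
  have ex x : exists stx : nat -> option (state K), x \in xs ->
    exists rho, [/\ forall p, stx p = Some (rho p), rho 0 \in init K,
      forall i, trans (rho i) (rho i.+1) & forall i, sigma x i = label (rho i)].
    case: (boolP (x \in xs)) => [xxs|_]; last by exists (fun=> None).
    have [rho [r1 r2 r3]] := sg_tr x xxs.
    by exists (fun p => Some (rho p)) => _; exists rho.
  by have [st stP] := choice ex; exists st.
pose m := #|state K|.
pose w := tword xs sigma t.
pose rk (q : option (state K)) : nat := oapp (fun q => enum_rank q : nat) 0 q.
(* The intended bits of the node at time [k], sorted by the residue of the bit position modulo 3. *)
pose P k i := if i %% 3 == 0 then t k (i %/ 3)
  else if i %% 3 == 1 then
    `[< exists f, code_pformula f = i %/ 3 /\ ev w k f >]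
  else has (fun x => x * m + rk (st x (pos t x k)) == i %/ 3) xs.
have nodes k : exists v, v < 2 ^ node_bits nK X nphi /\
    forall i, i < node_bits nK X nphi -> testbit v i = P k i.
  by have [v ltv vP] := testbit_exists (P k) (node_bits nK X nphi); exists v.
have [rho rhoP] := choice nodes.
have mvE k x : x \in xs -> node_moves (rho k) x = t k x.
  by move=> xxs; rewrite /node_moves (rhoP k).2 ?bits_moves // /P modnMr mulKn.
have hdE k f : code_pformula f \in decode (nsubs nphi) ->
    node_holds (rho k) (code_pformula f) = `[< ev w k f >].
  move=> fphi; rewrite /node_holds (rhoP k).2 ?bits_holds // /P.
  rewrite mulnC modnMDl /= divnMDl // divn_small // addn0.
  by apply: asbool_equiv_eq; split=> [[g [/code_pformula_inj->]]//|]; exists f.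
have rk_lt q : rk (Some q) < m by rewrite /= ltn_ord.
have stE x : x \in xs -> exists rh : nat -> state K,
    [/\ forall k, node_state nK (rho k) x = enum_rank (rh (pos t x k)),
        rh 0 \in init K, forall i, trans (rh i) (rh i.+1) &
        forall i, sigma x i = label (rh i)].
  move=> xxs; have [rh [r0 r1 r2 r3]] := stP x xxs; exists rh; split=> // k.
  rewrite /node_state nstatesE; apply: find_iotaE => [|| s lts]; first exact: ltn_ord.
    rewrite (rhoP k).2; last by rewrite bits_state.
    rewrite /P mulnC modnMDl /= divnMDl // divn_small // addn0.
    by apply/hasP; exists x; rewrite // r0.
  rewrite (rhoP k).2; last by apply: bits_state => //; apply: ltn_trans lts (ltn_ord _).
  rewrite /P mulnC modnMDl /= divnMDl // divn_small // addn0.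
  (* Quotient and remainder by the number of states recover both the trace and its state, so a state
     bit set for another trace cannot be mistaken for one of [x]. *)
  apply/hasPn => y yxs; apply/eqP => /(congr1 (fun i => (i %/ m, i %% m))).
  have lty : rk (st y (pos t y k)) < m.
    by have [ry [-> _ _ _]] := stP y yxs.
  have lts' : s < m by apply: ltn_trans lts _; exact: ltn_ord.
  have m0 : 0 < m by case: (m) lts'.
  rewrite !divnMDl // !modnMDl !modn_small // !divn_small // !addn0 => -[yx].
  by rewrite yx r0 /= => ES; move: lts; rewrite ES ltnn.
have J0 : 0 < size (decode X) + size (decode (nsubs nphi)).
  by rewrite nsubsE subcodesE addnS.
apply/(fair_certP _ _ _ _ J0).
rewrite nsubsE in hdE.
exists rho; split=> [k|| k | j k].
- by have [] := rhoP k.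
- rewrite /node_init hdE ?subcodes_refl // asboolT //= codeK; apply/allP => x xxs.
  by have [rh [-> r0 _ _]] := stE x xxs; rewrite ninitE.
- rewrite /node_edge codeK; apply/andP; split; first (apply/andP; split).
  + apply/allP => x xxs; have [rh [rhE r0 r1 r2]] := stE x xxs.
    rewrite !rhE nstatesE !ltn_ord /= mvE //; case: (t k x).
      by rewrite addn1 ntransE.
    by rewrite addn0.
  + have [[x tx] txs] := vt k; apply/hasP; exists x; first exact: txs.
    by rewrite mvE //; apply: txs.
  apply/allP => c; rewrite nsubsE => cphi; have [f fE] := subcodesP cphi.
  rewrite {c}fE in cphi *; have sub := subcodes_trans cphi.
  have hd l := hdE l _ cphi; have {}hdE l g (fg : code_pformula g \in subcodes f) := hdE l g (sub _ fg).
  rewrite /node_local; case: f {cphi sub} hd hdE => [|a x|f|f g|f g|f] hd hdE;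
    rewrite !fld_code [nth _ _ 0]/= [nth _ _ 1]/= [nth _ _ 2]/= ?[if _ then _ else _]/=.
  + by rewrite hd asboolT.
  + rewrite hd codeK (asboolb (tword xs sigma t k a x)) /tword /=.
    have [xxs|//] := boolP (x \in xs).
    by have [rh [-> _ _ r2]] := stE x xxs; rewrite nlabelE r2.
  + have cf : code_pformula f \in subcodes (PNot f).
      by rewrite subcodesE in_cons subcodes_refl orbT.
    by rewrite hd (hdE _ _ cf); apply/eqP; apply: asbool_neg.
  + have cf : code_pformula f \in subcodes (POr f g).
      by rewrite subcodesE in_cons mem_cat subcodes_refl orbT.
    have cg : code_pformula g \in subcodes (POr f g).
      by rewrite subcodesE in_cons mem_cat subcodes_refl !orbT.
    by rewrite hd (hdE _ _ cf) (hdE _ _ cg); apply/eqP; apply: asbool_or.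
  + have cf : code_pformula f \in subcodes (PUntil f g).
      by rewrite subcodesE in_cons mem_cat subcodes_refl orbT.
    have cg : code_pformula g \in subcodes (PUntil f g).
      by rewrite subcodesE in_cons mem_cat subcodes_refl !orbT.
    rewrite !hd (hdE _ _ cf) (hdE _ _ cg); apply/eqP.
    by rewrite -asbool_and -asbool_or; apply: asbool_equiv_eq; apply: ev_until.
  + have cf : code_pformula f \in subcodes (PNext f).
      by rewrite subcodesE in_cons subcodes_refl orbT.
    rewrite hd.
    change (`[< ev w k (PNext f) >] == node_holds (rho k.+1) (code_pformula f)).
    by rewrite (hdE _ _ cf).
rewrite /node_fair codeK => ltJ; case: (ltnP j (size xs)) => [ltj|lej].
  rewrite fld_code; have [l lel tl] := ft.2 _ (mem_nth 0 ltj) k.+1.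
  by exists l => //; rewrite mvE ?mem_nth.
set c := fld (nsubs nphi) _.
have : c \in subcodes phi.
  by rewrite -nsubsE /c /fld mem_nth // ltn_subLR.
move=> cphi; have [f fE] := subcodesP cphi; rewrite {c}fE in cphi *.
have sub := subcodes_trans cphi.
case: f sub cphi => [|a x|f|f g|f g|f] sub cphi;
  rewrite !fld_code [nth _ _ 0]/= [_ == 4]/=; try by exists k.+1.
suff [l ltl Hl] : exists2 l, k < l & node_holds (rho l) (code_pformula (PUntil f g))
    ==> node_holds (rho l) (code_pformula g) by exists l.
have gphi : code_pformula g \in subcodes phi.
  by apply: sub; rewrite subcodesE inE mem_cat subcodes_refl !orbT.
(* Either the until fails at some later time, or it holds at [k.+1] and its right-hand side is met
   from there. *)
have [fin|] := pselect (exists2 l, k < l & ~ ev w l (PUntil f g)).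
  by have [l ltl nl] := fin; exists l => //; rewrite hdE // asboolF.
move=> inf; have : ev w k.+1 (PUntil f g).
  by apply: contrapT => nu; apply: inf; exists k.+1.
move=> [i [gi _]]; exists (k.+1 + i); first by rewrite addSn ltnS leq_addr.
by rewrite !hdE // [X in _ ==> X]asboolT ?implybT.
Qed.

Lemma exists_fair_path_sound : exists_fair_path nK X nphi ->
  exists sigma, {in xs, forall x, is_trace K (sigma x)} /\
    exists2 t, ftraj xs t & ev (tword xs sigma t) 0 phi.
Proof.
have J0 : 0 < size (decode X) + size (decode (nsubs nphi)).
  by rewrite nsubsE subcodesE addnS.
move=> /(fair_certP _ _ _ _ J0)[rho [_ /andP[phi0 init0] rhoE rhoF]].
rewrite codeK in J0 rhoF init0.
have edge k : [/\ {in xs, forall x,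
      [/\ node_state nK (rho k) x < #|state K|,
          node_state nK (rho k.+1) x < #|state K| &
          if node_moves (rho k) x
          then ntrans nK (node_state nK (rho k) x) (node_state nK (rho k.+1) x)
          else node_state nK (rho k.+1) x == node_state nK (rho k) x]},
    exists2 x, x \in xs & node_moves (rho k) x &
    {in subcodes phi, forall c, node_local nK X (rho k) (rho k.+1) c}].
  have := rhoE k; rewrite /node_edge codeK nsubsE nstatesE.
  move=> /andP[/andP[/allP e1 /hasP e2] /allP e3]; split=> // x xxs.
  by have /andP[/andP[-> ->] tr] := e1 x xxs.
pose t : trajectory := fun k x => (x \in xs) && node_moves (rho k) x.
have ft : ftraj xs t.
  split=> [k|x xxs i].
    have [_ [x xxs mv] _] := edge k; split; last by move=> y /andP[].
    by exists x; apply/andP.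
  have ltx : index x xs < size xs by rewrite index_mem.
  have [|l ltl Fl] := rhoF (index x xs) i; first exact: ltn_addr.
  exists l; first exact: ltnW.
  by move: Fl; rewrite /node_fair codeK ltx fld_code nth_index // => mv; apply/andP.
have ex_tr x : exists tau : trace AP, x \in xs ->
    is_trace K tau /\ forall k (a : AP),
      (a \in tau (pos t x k)) = nlabel nK (node_state nK (rho k) x) (code_elt a).
  case: (boolP (x \in xs)) => [xxs|_]; last by exists (fun=> set0).
  have lts k : node_state nK (rho k) x < #|state K|.
    by have [/(_ x xxs)[]] := edge k.
  pose Q k : state K := enum_val (Ordinal (lts k)).
  have QE k : enum_rank (Q k) = node_state nK (rho k) x :> nat.
    by rewrite /Q enum_valK.
  have step k : if t k x then trans (Q k) (Q k.+1) else Q k.+1 == Q k.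
    have [/(_ x xxs)[_ _ +] _ _] := edge k.
    rewrite -!QE /t xxs /=; case: ifP => _; first by rewrite ntransE.
    by move=> /eqP/val_inj/enum_rank_inj/eqP.
  have same k d : pos t x (k + d) = pos t x k -> Q (k + d) = Q k.
    elim: d => [|d IHd]; first by rewrite addn0.
    have := step (k + d); rewrite addnS /=; case: (t _ _) => [_ E|/eqP-> E].
      by have := pos_le t x (leq_addr d k); rewrite -E addn1 ltnn.
    by apply: IHd; rewrite addn0 in E.
  (* The state of [x] is constant while its pointer rests, so the path of [K] is sampled at the
     switch times. *)
  have [T [T0 Tlt TE]] := switch_times ft xxs.
  have posT p : pos t x (T p) = p by apply/eqP; rewrite -TE leqnn Tlt.
  have QT k : Q k = Q (T (pos t x k)).
    have /andP[leT _] : T (pos t x k) <= k < T (pos t x k).+1 by rewrite TE.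
    by rewrite -{1}(subnKC leT) same // subnKC // posT.
  exists (fun p => label (Q (T p))) => _; split; last first.
    by move=> k a; rewrite -QT -QE nlabelE.
  exists (fun p => Q (T p)); split=> // [|p].
    by rewrite T0 -ninitE QE (allP init0).
  (* The time just before [T p.+1] still belongs to position [p], and the step taken there is the
     transition wanted. *)
  have gt0 : 0 < T p.+1 by apply: leq_ltn_trans (Tlt p).
  have pE : pos t x (T p.+1).-1 = p.
    by apply/eqP; rewrite -TE prednK // -ltnS prednK // Tlt leqnn.
  have := step (T p.+1).-1; rewrite prednK // QT pE.
  have := posT p.+1; rewrite -(prednK gt0) /= pE.
  by case: (t _ _) => //; rewrite addn0 => /n_Sn.
have [sigma sigP] := choice ex_tr.
exists sigma; split=> [x /sigP[]//|]; exists t => //.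
pose w := tword xs sigma t.
suff H f : {subset subcodes f <= subcodes phi} ->
    forall k, node_holds (rho k) (code_pformula f) <-> ev w k f.
  by apply/H.
elim: f => [|a x|f IHf|f IHf g IHg|f IHf g IHg|f IHf] sub k;
  have [_ _ /(_ _ (sub _ (subcodes_refl _)))] := edge k;
  rewrite /node_local !fld_code [nth _ _ 0]/= [nth _ _ 1]/= [nth _ _ 2]/=.
- change (node_holds (rho k) (code_pformula (@PTrue AP)) ->
    node_holds (rho k) (code_pformula (@PTrue AP)) <-> True).
  by split.
- change (node_holds (rho k) (code_pformula (PAtom a x)) ==
    (x \in decode X) && nlabel nK (node_state nK (rho k) x) (code_elt a) ->
    node_holds (rho k) (code_pformula (PAtom a x)) <-> w k a x).
  move=> /eqP ->; rewrite codeK /w /tword.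
  by have [/sigP[_ ->]|] := boolP (x \in xs).
- have {IHf} IH : forall k, node_holds (rho k) (code_pformula f) <-> ev w k f.
    by apply: IHf => c cf; apply: sub; rewrite subcodesE in_cons cf orbT.
  change (node_holds (rho k) (code_pformula (PNot f)) ==
    ~~ node_holds (rho k) (code_pformula f) ->
    node_holds (rho k) (code_pformula (PNot f)) <-> ~ ev w k f).
  by move=> /eqP->; rewrite -IH; split=> /negP.
- have {}IHf : forall k, node_holds (rho k) (code_pformula f) <-> ev w k f.
    by apply: IHf => c cf; apply: sub; rewrite subcodesE in_cons mem_cat cf orbT.
  have {}IHg : forall k, node_holds (rho k) (code_pformula g) <-> ev w k g.
    by apply: IHg => c cf; apply: sub; rewrite subcodesE in_cons mem_cat cf !orbT.
  change (node_holds (rho k) (code_pformula (POr f g)) ==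
    node_holds (rho k) (code_pformula f) || node_holds (rho k) (code_pformula g) ->
    node_holds (rho k) (code_pformula (POr f g)) <-> ev w k f \/ ev w k g).
  by move=> /eqP->; rewrite -IHf -IHg; split=> /orP.
- have {}IHf : forall k, node_holds (rho k) (code_pformula f) <-> ev w k f.
    by apply: IHf => c cf; apply: sub; rewrite subcodesE in_cons mem_cat cf orbT.
  have {}IHg : forall k, node_holds (rho k) (code_pformula g) <-> ev w k g.
    by apply: IHg => c cf; apply: sub; rewrite subcodesE in_cons mem_cat cf !orbT.
  move=> _; set c := code_pformula (PUntil f g).
  have cphi : c \in subcodes phi by apply: sub; apply: subcodes_refl.
  have loc l : node_holds (rho l) c = node_holds (rho l) (code_pformula g) ||
      (node_holds (rho l) (code_pformula f) && node_holds (rho l.+1) c).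
    have [_ _ /(_ _ cphi)] := edge l.
    rewrite /node_local !fld_code [nth _ _ 0]/= [nth _ _ 1]/= [nth _ _ 2]/=.
    by move/eqP.
  split=> [ck|[i [gi fj]]]; last first.
    have H d : d <= i -> node_holds (rho (k + (i - d))) c.
      elim: d => [_|d IHd ltd]; first by rewrite subn0 loc (proj2 (IHg _) gi).
      rewrite loc; apply/orP; right; apply/andP; split.
        by apply/IHf/fj; rewrite ltn_subrL (leq_trans _ ltd).
      by rewrite -addnS -subSn // subSS IHd // ltnW.
    by have := H i (leqnn i); rewrite subnn addn0.
  have [j ltj jc] : exists2 j, j < size (decode (nsubs nphi)) & fld (nsubs nphi) j = c.
    by exists (index c (subcodes phi)); rewrite /fld nsubsE ?index_mem ?nth_index.
  have [|l ltkl] := rhoF (size xs + j) k; first by rewrite ltn_add2l.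
  rewrite /node_fair codeK ifN -?leqNgt ?leq_addr // addKn jc.
  have -> : fld c 0 = 4 by rewrite fld_code.
  have -> : fld c 2 = code_pformula g by rewrite fld_code.
  move=> /implyP/(_ isT)/implyP cg; apply: contrapT => nu.
  (* An until whose right-hand side is never met is handed on for ever by its unfolding, whereas the
     fairness condition gives a later [l] at which the right-hand side accompanies it. *)
  have H d : node_holds (rho (k + d)) c /\ forall j, j <= d -> ~ ev w (k + j) g.
    suff H : node_holds (rho (k + d)) c /\ forall j, j < d ->
        ev w (k + j) f /\ ~ ev w (k + j) g.
      have [cd fg] := H; split=> // i; rewrite leq_eqVlt => /predU1P[->|/fg[]//] gd.
      by apply: nu; exists d; split=> // i' /fg[].
    elim: d => [|d [cd fg]]; first by rewrite addn0.
    have ngd : ~ ev w (k + d) g.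
      by move=> gd; apply: nu; exists d; split=> // i' /fg[].
    move: cd; rewrite loc => /orP[/IHg//|/andP[/IHf fd cd]].
    split=> [|i]; first by rewrite addnS.
    by rewrite ltnS leq_eqVlt => /predU1P[->//|/fg].
  have El : k + (l - k) = l by apply/subnKC/ltnW.
  have [cl ngl] := H (l - k); rewrite El in cl.
  by apply: (ngl (l - k) (leqnn _)); rewrite El; apply/IHg/cg.
- have {}IHf : forall k, node_holds (rho k) (code_pformula f) <-> ev w k f.
    by apply: IHf => c cf; apply: sub; rewrite subcodesE in_cons cf orbT.
  change (node_holds (rho k) (code_pformula (PNext f)) ==
    node_holds (rho k.+1) (code_pformula f) ->
    node_holds (rho k) (code_pformula (PNext f)) <-> ev w k.+1 f).
  by move=> /eqP->.
Qed.

End TableauCorrect.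

(** * The transformation on codes *)

Definition nTrue : nat := code [:: 0].
Definition nAtom a x : nat := code [:: 1; a; x].
Definition nNot f : nat := code [:: 2; f].
Definition nOr f g : nat := code [:: 3; f; g].
Definition nUntil f g : nat := code [:: 4; f; g].
Definition nNext f : nat := code [:: 5; f].
Definition nFalse : nat := nNot nTrue.
Definition nAnd f g : nat := nNot (nOr (nNot f) (nNot g)).
Definition nImpl f g : nat := nOr (nNot f) g.
Definition nBox f : nat := nNot (nUntil nTrue (nNot f)).
Definition nbigor (L : nat) : nat := foldr nOr nFalse (decode L).
Definition nbigand (L : nat) : nat := foldr nAnd nTrue (decode L).
Definition ndiff a x : nat :=
  nNot (nAnd (nImpl (nAtom a x) (nNext (nAtom a x)))
             (nImpl (nNext (nAtom a x)) (nAtom a x))).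
Definition nconst a x : nat := nOr (nBox (nAtom a x)) (nBox (nNot (nAtom a x))).

Definition nimp_triple f g : nat :=
  if [&& fld f 0 == 2, fld (fld f 1) 0 == 1, fld g 0 == 1 &
         fld (fld f 1) 2 != fld g 2]
  then code [:: code [:: fld (fld f 1) 1; fld (fld f 1) 2; fld g 2]] else 0.

Definition ntriples : nat -> nat := nfold (fun c r s =>
  if (fld c 0 == 2) || (fld c 0 == 5) then r
  else if fld c 0 == 3 then
    code (decode (nimp_triple (fld c 1) (fld c 2)) ++ decode r ++ decode s)
  else if fld c 0 == 4 then code (decode r ++ decode s)
  else 0).

Definition nphase_triples : nat -> nat := nfold (fun c r s =>
  if fld c 0 == 2 then r
  else if fld c 0 == 3 then code (decode r ++ decode s)
  else if fld c 0 == 4 then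
    code (decode (ntriples (fld c 1)) ++ decode (ntriples (fld c 2)))
  else 0).

Definition nsubst_phase (b : bool) : nat -> nat := nfold (fun c r s =>
  if fld c 0 == 2 then nNot r
  else if fld c 0 == 3 then nOr r s
  else if (fld c 0 == 4) &&
          (size (decode (ntriples (fld c 1)) ++ decode (ntriples (fld c 2))) != 0)
  then (if b then nTrue else nFalse)
  else c).

(** The initial list [[:: 0]] holds only the empty list, whose code is [0]; accordingly the tests
    against [0] in [nstuck] select nonempty sets. *)
Definition nsublists (X : nat) : nat :=
  code (foldr (fun x acc => acc ++ [seq code (x :: decode u) | u <- acc])
              [:: 0] (decode X)).

Definition nblocked C N t : nat :=
  if fld t 1 \in decode N then
    nAnd (ndiff (fld t 0) (fld t 1))
      (if fld t 2 \in decode N then nNot (ndiff (fld t 0) (fld t 2))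
       else if fld t 2 \in decode C then nTrue else nconst (fld t 0) (fld t 2))
  else nFalse.

Definition nstuck X L : nat :=
  nbigor (code [seq nbigand (code [seq nbigor (code [seq nblocked C N t
                                                    | t <- decode L])
                                  | N <- decode (nsublists C) & N != 0])
               | C <- decode (nsublists X) & C != 0]).

Definition nin_phase L : nat :=
  nbigand (code [seq nImpl (nAtom (fld t 0) (fld t 1)) (nAtom (fld t 0) (fld t 2))
                | t <- decode L]).

Definition nalways_in_phase L : nat :=
  nbigand (code [seq nOr (nBox (nNot (nAtom (fld t 0) (fld t 1))))
                         (nBox (nAtom (fld t 0) (fld t 2))) | t <- decode L]).

Definition nnever_aligned X L : nat :=
  nOr (nNot (nin_phase L))
      (nUntil (nin_phase L) (nAnd (nin_phase L) (nstuck X L))).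

Definition nforall_traj X f : nat :=
  nOr (nAnd (nsubst_phase false f) (nsubst_phase true f))
  (nOr (nAnd (nsubst_phase false f) (nalways_in_phase (nphase_triples f)))
       (nAnd (nsubst_phase true f) (nnever_aligned X (nphase_triples f)))).

(** Quantifiers carry the tags 0 and 1, trajectory modalities 2 and 3. On the latter [strip] is the
    identity, so the code itself can serve as a generous number of rounds. *)
Definition strip (f : nat) : nat := if fld f 0 < 2 then fld f 2 else f.
Definition nvars (F : nat) : nat :=
  code [seq fld (iter k strip F) 1 | k <- [seq k <- iota 0 F | fld (iter k strip F) 0 < 2]].
Definition nbody (F : nat) : nat := fld (iter F strip F) 1.

Definition decideE K X f : bool := exists_fair_path K X f.
(** There is no trajectory over an empty set of variables, so without quantifiers [A] holds
    vacuously. *)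
Definition decideA K X f : bool :=
  (X == 0) || exists_fair_path K X (nforall_traj X f).

Definition decide (Q : quantifier) (M : modality) (i : nat) : bool :=
  match Q, M with
  | Exists, ModE => decideE (fld i 0) (nvars (fld i 1)) (nbody (fld i 1))
  | Exists, ModA => decideA (fld i 0) (nvars (fld i 1)) (nbody (fld i 1))
  | Forall, ModE =>
      ~~ decideA (fld i 0) (nvars (fld i 1)) (nNot (nbody (fld i 1)))
  | Forall, ModA =>
      ~~ decideE (fld i 0) (nvars (fld i 1)) (nNot (nbody (fld i 1)))
  end.

(** * Recursiveness of the decision procedure *)

Notation arg0 := (head 0).
Notation arg1 e := (head 0 (behead e)).
Notation arg2 e := (head 0 (behead (behead e))).
Notation arg3 e := (head 0 (behead (behead (behead e)))).
Notation arg4 e := (head 0 (behead (behead (behead (behead e))))).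

Lemma rec_nAtom : rec (fun e => nAtom (arg0 e) (arg1 e)).
Proof. rewrite /nAtom; rec_tac. Qed.
Lemma rec_nNot : rec (fun e => nNot (arg0 e)).
Proof. rewrite /nNot; rec_tac. Qed.
Lemma rec_nOr : rec (fun e => nOr (arg0 e) (arg1 e)).
Proof. rewrite /nOr; rec_tac. Qed.
Lemma rec_nUntil : rec (fun e => nUntil (arg0 e) (arg1 e)).
Proof. rewrite /nUntil; rec_tac. Qed.
Lemma rec_nNext : rec (fun e => nNext (arg0 e)).
Proof. rewrite /nNext; rec_tac. Qed.

#[local] Hint Resolve rec_nAtom rec_nNot rec_nOr rec_nUntil rec_nNext : rec_db.

Lemma rec_nAnd : rec (fun e => nAnd (arg0 e) (arg1 e)).
Proof. rewrite /nAnd; rec_tac. Qed.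
Lemma rec_nImpl : rec (fun e => nImpl (arg0 e) (arg1 e)).
Proof. rewrite /nImpl; rec_tac. Qed.
Lemma rec_nBox : rec (fun e => nBox (arg0 e)).
Proof. rewrite /nBox; rec_tac. Qed.
Lemma rec_nbigor : rec (fun e => nbigor (arg0 e)).
Proof.
exact: (rec_foldr (G := fun f r _ => nOr f r) rec_nOr
          (rec_const _) (rec_decode (rec_var 0))).
Qed.
Lemma rec_nbigand : rec (fun e => nbigand (arg0 e)).
Proof.
exact: (rec_foldr (G := fun f r _ => nAnd f r) rec_nAnd
          (rec_const _) (rec_decode (rec_var 0))).
Qed.

#[local] Hint Resolve rec_nAnd rec_nImpl rec_nBox rec_nbigor rec_nbigand : rec_db.

Lemma rec_ndiff : rec (fun e => ndiff (arg0 e) (arg1 e)).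
Proof. rewrite /ndiff; rec_tac. Qed.
Lemma rec_nconst : rec (fun e => nconst (arg0 e) (arg1 e)).
Proof. rewrite /nconst; rec_tac. Qed.
Lemma rec_nimp_triple : rec (fun e => nimp_triple (arg0 e) (arg1 e)).
Proof. rewrite /nimp_triple; rec_tac. Qed.
#[local] Hint Resolve rec_ndiff rec_nconst rec_nimp_triple : rec_db.

Lemma rec_ntriples : rec (fun e => ntriples (arg0 e)).
Proof. by rewrite /ntriples; apply: rec_nfold (rec_var 0); rec_tac. Qed.
#[local] Hint Resolve rec_ntriples : rec_db.

Lemma rec_nphase_triples : rec (fun e => nphase_triples (arg0 e)).
Proof. by rewrite /nphase_triples; apply: rec_nfold (rec_var 0); rec_tac. Qed.

Lemma rec_nsubst_phase b : rec (fun e => nsubst_phase b (arg0 e)).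
Proof. by rewrite /nsubst_phase; case: b; apply: rec_nfold (rec_var 0); rec_tac. Qed.

Lemma rec_nsublists : rec (fun e => nsublists (arg0 e)).
Proof. by rewrite /nsublists; rec_tac. Qed.

Lemma rec_nblocked : rec (fun e => nblocked (arg0 e) (arg1 e) (arg2 e)).
Proof. by rewrite /nblocked; rec_tac. Qed.
#[local] Hint Resolve rec_nphase_triples rec_nsubst_phase rec_nsublists rec_nblocked : rec_db.

Lemma rec_nstuck : rec (fun e => nstuck (arg0 e) (arg1 e)).
Proof. by rewrite /nstuck; rec_tac. Qed.

Lemma rec_nin_phase : rec (fun e => nin_phase (arg0 e)).
Proof. by rewrite /nin_phase; rec_tac. Qed.

Lemma rec_nalways_in_phase : rec (fun e => nalways_in_phase (arg0 e)).
Proof. by rewrite /nalways_in_phase; rec_tac. Qed.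
#[local] Hint Resolve rec_nstuck rec_nin_phase rec_nalways_in_phase : rec_db.

Lemma rec_nnever_aligned : rec (fun e => nnever_aligned (arg0 e) (arg1 e)).
Proof. by rewrite /nnever_aligned; rec_tac. Qed.
#[local] Hint Resolve rec_nnever_aligned : rec_db.

Lemma rec_nforall_traj : rec (fun e => nforall_traj (arg0 e) (arg1 e)).
Proof. by rewrite /nforall_traj; rec_tac. Qed.
#[local] Hint Resolve rec_nforall_traj : rec_db.

Lemma rec_strip : rec (fun e => strip (arg0 e)).
Proof. by rewrite /strip; rec_tac. Qed.
#[local] Hint Resolve rec_strip : rec_db.

Lemma rec_nvars : rec (fun e => nvars (arg0 e)).
Proof. by rewrite /nvars; rec_tac. Qed.

Lemma rec_nbody : rec (fun e => nbody (arg0 e)).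
Proof. by rewrite /nbody; rec_tac. Qed.
#[local] Hint Resolve rec_nvars rec_nbody : rec_db.

Lemma rec_nsubs : rec (fun e => nsubs (arg0 e)).
Proof. by rewrite /nsubs; apply: rec_nfold (rec_var 0); rec_tac. Qed.

Lemma rec_nstates : rec (fun e => nstates (arg0 e)).
Proof. by rewrite /nstates; rec_tac. Qed.

Lemma rec_ninit : rec (fun e => ninit (arg0 e) (arg1 e)).
Proof. by rewrite /ninit; rec_tac. Qed.

Lemma rec_ntrans : rec (fun e => ntrans (arg0 e) (arg1 e) (arg2 e)).
Proof. by rewrite /ntrans; rec_tac. Qed.

Lemma rec_nlabel : rec (fun e => nlabel (arg0 e) (arg1 e) (arg2 e)).
Proof. by rewrite /nlabel; rec_tac. Qed.

Lemma rec_node_moves : rec (fun e => node_moves (arg0 e) (arg1 e)).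
Proof. by rewrite /node_moves; rec_tac. Qed.

Lemma rec_node_holds : rec (fun e => node_holds (arg0 e) (arg1 e)).
Proof. by rewrite /node_holds; rec_tac. Qed.
#[local] Hint Resolve rec_nsubs rec_nstates rec_ninit rec_ntrans rec_nlabel
  rec_node_moves rec_node_holds : rec_db.

Lemma rec_node_state : rec (fun e => node_state (arg0 e) (arg1 e) (arg2 e)).
Proof. by rewrite /node_state; rec_tac. Qed.
#[local] Hint Resolve rec_node_state : rec_db.

Lemma rec_node_local :
  rec (fun e => node_local (arg0 e) (arg1 e) (arg2 e) (arg3 e) (arg4 e)).
Proof. by rewrite /node_local; rec_tac. Qed.
#[local] Hint Resolve rec_node_local : rec_db.

Lemma rec_node_edge :
  rec (fun e => node_edge (arg0 e) (arg1 e) (arg2 e) (arg3 e) (arg4 e)).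
Proof. by rewrite /node_edge; rec_tac. Qed.

Lemma rec_node_init :
  rec (fun e => node_init (arg0 e) (arg1 e) (arg2 e) (arg3 e)).
Proof. by rewrite /node_init; rec_tac. Qed.

Lemma rec_node_fair :
  rec (fun e => node_fair (arg0 e) (arg1 e) (arg2 e) (arg3 e)).
Proof. by rewrite /node_fair; rec_tac. Qed.

Lemma rec_node_bits : rec (fun e => node_bits (arg0 e) (arg1 e) (arg2 e)).
Proof. by rewrite /node_bits; rec_tac. Qed.
#[local] Hint Resolve rec_node_edge rec_node_init rec_node_fair rec_node_bits : rec_db.

Lemma rec_exists_fair_path :
  rec (fun e => exists_fair_path (arg0 e) (arg1 e) (arg2 e)).
Proof. by rewrite /exists_fair_path /fair_cert; rec_tac. Qed.
#[local] Hint Resolve rec_exists_fair_path : rec_db.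

Lemma rec_decideE : rec (fun e => decideE (arg0 e) (arg1 e) (arg2 e)).
Proof. by rewrite /decideE; rec_tac. Qed.

Lemma rec_decideA : rec (fun e => decideA (arg0 e) (arg1 e) (arg2 e)).
Proof. by rewrite /decideA; rec_tac. Qed.
#[local] Hint Resolve rec_decideE rec_decideA : rec_db.

Lemma rec_decide Q M : rec (fun e => decide Q M (arg0 e)).
Proof. by case: Q; case: M; rewrite /decide; rec_tac. Qed.

(** * Correctness of the transformation on codes *)

Arguments code_pformula : simpl never.
Arguments code : simpl never.
Arguments code_formula : simpl never.

Section Mirror.
Variable AP : finType.
Implicit Types (f g : pformula AP) (xs C N : seq var).
Local Notation cf := (@code_pformula AP).

Definition code_triple (t : AP * var * var) : nat :=
  code [:: code_elt t.1.1; t.1.2; t.2].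

Lemma fld_tag f : fld (cf f) 0 = match f with
  | PTrue => 0 | PAtom _ _ => 1 | PNot _ => 2 | POr _ _ => 3
  | PUntil _ _ => 4 | PNext _ => 5 end.
Proof. by rewrite /fld decode_pformula; case: f. Qed.

Lemma fld_arg1 f : fld (cf f) 1 = match f with
  | PTrue => 0 | PAtom a _ => code_elt a | PNot f | PNext f => cf f
  | POr f _ | PUntil f _ => cf f end.
Proof. by rewrite /fld decode_pformula; case: f. Qed.

Lemma fld_arg2 f : fld (cf f) 2 = match f with
  | PTrue => 0 | PAtom _ x => x | PNot f | PNext f => 0
  | POr _ g | PUntil _ g => cf g end.
Proof. by rewrite /fld decode_pformula; case: f. Qed.

Definition fldE := (fld_tag, fld_arg1, fld_arg2).

Lemma nimp_tripleE f g :
  nimp_triple (cf f) (cf g) = code (map code_triple (imp_triple f g)).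
Proof.
rewrite /nimp_triple !fldE.
case: f => [|a x|[|a x|f|f f'|f f'|f]|f f'|f f'|f] //=; rewrite ?fldE //=;
  case: g => [|b y|g|g g'|g g'|g] //=; rewrite ?fldE //.
by case: (x == y).
Qed.

Lemma ntriplesE f : decode (ntriples (cf f)) = map code_triple (triples f).
Proof.
have eqn c : 0 < c -> ntriples c =
    if (fld c 0 == 2) || (fld c 0 == 5) then ntriples (fld c 1)
    else if fld c 0 == 3 then
      code (decode (nimp_triple (fld c 1) (fld c 2)) ++
            decode (ntriples (fld c 1)) ++ decode (ntriples (fld c 2)))
    else if fld c 0 == 4 then
      code (decode (ntriples (fld c 1)) ++ decode (ntriples (fld c 2)))
    else 0 by exact: nfoldE.
elim: f => [|a x|f IHf|f IHf g IHg|f IHf g IHg|f IHf];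
  rewrite eqn ?code_pformula_gt0 // !fldE //=.
- by rewrite nimp_tripleE !codeK IHf IHg !map_cat.
- by rewrite codeK IHf IHg map_cat.
Qed.

Lemma nphase_triplesE f :
  decode (nphase_triples (cf f)) = map code_triple (phase_triples f).
Proof.
have eqn c : 0 < c -> nphase_triples c =
    if fld c 0 == 2 then nphase_triples (fld c 1)
    else if fld c 0 == 3 then
      code (decode (nphase_triples (fld c 1)) ++ decode (nphase_triples (fld c 2)))
    else if fld c 0 == 4 then
      code (decode (ntriples (fld c 1)) ++ decode (ntriples (fld c 2)))
    else 0 by exact: nfoldE.
elim: f => [|a x|f IHf|f IHf g IHg|f IHf g IHg|f IHf];
  rewrite eqn ?code_pformula_gt0 // !fldE //=.
- by rewrite codeK IHf IHg map_cat.
- by rewrite codeK !ntriplesE map_cat.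
Qed.

Lemma nsubst_phaseE b f : nsubst_phase b (cf f) = cf (subst_phase b f).
Proof.
have eqn c : 0 < c -> nsubst_phase b c =
    if fld c 0 == 2 then nNot (nsubst_phase b (fld c 1))
    else if fld c 0 == 3 then
      nOr (nsubst_phase b (fld c 1)) (nsubst_phase b (fld c 2))
    else if (fld c 0 == 4) && (size (decode (ntriples (fld c 1)) ++
                                     decode (ntriples (fld c 2))) != 0)
    then (if b then nTrue else nFalse) else c by exact: nfoldE.
elim: f => [|a x|f IHf|f IHf g IHg|f IHf g IHg|f IHf];
  rewrite eqn ?code_pformula_gt0 // !fldE //=.
- by rewrite IHf.
- by rewrite IHf IHg.
- rewrite !ntriplesE -map_cat size_map /nilp.
  by case: eqP => //= _; case: b {eqn IHf IHg}.
Qed.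

Lemma nsublistsE xs : decode (nsublists (code xs)) = map code (subs xs).
Proof.
rewrite /nsublists !codeK; elim: xs => //= x xs ->.
rewrite map_cat -!map_comp; congr cat; apply: eq_map => u /=.
by rewrite codeK.
Qed.

Lemma nblockedE C N t :
  nblocked (code C) (code N) (code_triple t) = cf (blocked C N t).
Proof.
case: t => [[a x] y]; rewrite /nblocked /code_triple !fld_code !codeK /=.
by case: (x \in N); case: (y \in N); case: (y \in C).
Qed.

Lemma nbigorE (fs : seq (pformula AP)) : nbigor (code (map cf fs)) = cf (bigor fs).
Proof. by rewrite /nbigor codeK; elim: fs => //= f fs ->. Qed.

Lemma nbigandE (fs : seq (pformula AP)) : nbigand (code (map cf fs)) = cf (bigand fs).
Proof. by rewrite /nbigand codeK; elim: fs => //= f fs ->. Qed.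

Lemma code_eq0 s : (code s == 0) = (s == [::]).
Proof. exact: (can_eq codeK s [::]). Qed.

Lemma filter_code (ss : seq (seq nat)) :
  [seq c <- map code ss | c != 0] = map code [seq s <- ss | s != [::]].
Proof. by rewrite filter_map; congr map; apply: eq_filter => s /=; rewrite code_eq0. Qed.

Variable L : seq (AP * var * var).
Local Notation nL := (code (map code_triple L)).

Lemma nstuckE xs : nstuck (code xs) nL = cf (stuck xs L).
Proof.
rewrite /nstuck /stuck -nbigorE nsublistsE filter_code -!map_comp.
congr (nbigor (code _)); apply: eq_map => C /=.
rewrite -nbigandE nsublistsE filter_code -!map_comp.
congr (nbigand (code _)); apply: eq_map => N /=.
rewrite -nbigorE codeK -!map_comp.
by congr (nbigor (code _)); apply: eq_map => t /=; rewrite nblockedE.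
Qed.

Lemma nin_phaseE : nin_phase nL = cf (in_phase L).
Proof.
rewrite /nin_phase /in_phase -nbigandE codeK -!map_comp.
congr (nbigand (code _)); apply: eq_map => t /=.
by rewrite /code_triple !fld_code.
Qed.

Lemma nalways_in_phaseE : nalways_in_phase nL = cf (always_in_phase L).
Proof.
rewrite /nalways_in_phase /always_in_phase -nbigandE codeK -!map_comp.
congr (nbigand (code _)); apply: eq_map => t /=.
by rewrite /code_triple !fld_code.
Qed.

Lemma nnever_alignedE xs : nnever_aligned (code xs) nL = cf (never_aligned xs L).
Proof. by rewrite /nnever_aligned nin_phaseE nstuckE. Qed.

End Mirror.

Lemma nforall_trajE (AP : finType) xs (f : pformula AP) :
  nforall_traj (code xs) (code_pformula f) = code_pformula (forall_traj xs f).
Proof.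
rewrite /nforall_traj -[nphase_triples _]decodeK nphase_triplesE.
by rewrite !nsubst_phaseE nalways_in_phaseE nnever_alignedE.
Qed.

(** * Quantifier prefixes and correctness of the decision procedure *)

Section Prefix.
Variable AP : finType.
Implicit Types (f : pformula AP) (phi : formula AP).

Lemma fld_quant Q x phi j : fld (code_formula (Quant Q x phi)) j =
  nth 0 [:: if Q is Forall then 0 else 1; x; code_formula phi] j.
Proof. by case: Q; apply: fld_code. Qed.

Lemma fld_traj M f j : fld (code_formula (Traj M f)) j =
  nth 0 [:: if M is ModE then 2 else 3; code_pformula f] j.
Proof. by case: M; apply: fld_code. Qed.

(** The first [size xs] iterates begin with a quantifier and reveal the variables in order; all
    further ones are the trajectory formula, which the filter discards. *)
Lemma strip_prefixed Q xs M f n (F := code_formula (prefixed Q xs M f)) :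
  size xs <= n ->
  [seq fld (iter k strip F) 1 | k <- [seq k <- iota 0 n | fld (iter k strip F) 0 < 2]]
    = xs /\ fld (iter n strip F) 1 = code_pformula f.
Proof.
rewrite /F {F}; elim: xs n => [|x xs IHxs] n.
  move=> _; rewrite /prefixed /=.
  have F0 : (fld (code_formula (Traj M f)) 0 < 2) = false.
    by rewrite fld_traj; case: (M).
  have F1 := fld_traj M f 1; set F := code_formula _ in F0 F1 *.
  have itF k : iter k strip F = F.
    by elim: k => //= k ->; rewrite /strip F0.
  rewrite itF (eq_filter (a2 := pred0)) ?filter_pred0 //.
  by move=> k; rewrite itF F0.
case: n => // n; rewrite ltnS => /IHxs[E1 E2].
rewrite -[prefixed _ _ _ _]/(Quant Q x (prefixed Q xs M f)).
have F0 : fld (code_formula (Quant Q x (prefixed Q xs M f))) 0 < 2.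
  by rewrite fld_quant; case: (Q).
have F1 := fld_quant Q x (prefixed Q xs M f) 1.
have F2 := fld_quant Q x (prefixed Q xs M f) 2.
set F := code_formula (prefixed Q xs M f) in E1 E2 F2.
set F' := code_formula _ in F0 F1 F2 *.
have sF : strip F' = F by rewrite /strip F0.
rewrite iterSr sF; split=> //.
rewrite -[iota 0 n.+1]/(0 :: iota (1 + 0) n) iotaDl /= F0 /= F1; congr cons.
rewrite filter_map -map_comp -[RHS]E1.
rewrite (eq_filter (a2 := fun k => fld (iter k strip F) 0 < 2)).
  by apply: eq_map => k /=; rewrite -iterS iterSr sF.
by move=> k /=; rewrite -iterS iterSr sF.
Qed.

Lemma code_formula_gt Q x phi : code_formula phi < code_formula (Quant Q x phi).
Proof.
have H s y : y \in s -> y < code s by move=> ys; apply: (allP (ltn_code s)).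
by case: Q; apply: H; rewrite !inE eqxx !orbT.
Qed.

Lemma size_prefix Q xs M f : size xs <= code_formula (prefixed Q xs M f).
Proof.
by elim: xs => //= x xs IHxs; apply: leq_ltn_trans IHxs (code_formula_gt _ _ _).
Qed.

Lemma nvarsE Q xs M f : nvars (code_formula (prefixed Q xs M f)) = code xs.
Proof.
by rewrite /nvars; have [-> _] := strip_prefixed Q M f (size_prefix Q xs M f).
Qed.

Lemma nbodyE Q xs M f :
  nbody (code_formula (prefixed Q xs M f)) = code_pformula f.
Proof. by have [] := strip_prefixed Q M f (size_prefix Q xs M f). Qed.

Lemma decideEP (K : kripke AP) xs f :
  decideE (code_kripke K) (code xs) (code_pformula f) <->
  models K (prefixed Exists xs ModE f).
Proof.
rewrite models_Exists; split.
  move=> /exists_fair_path_sound[sigma [sg_tr ex]]; exists sigma => //.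
  exact/sat_ModE.
move=> [sigma sg_tr /sat_ModE[t ft evt]].
exact: exists_fair_path_complete sg_tr ft evt.
Qed.

Lemma decideAP (K : kripke AP) xs f :
  bool_comb (@phase_or_co AP) 1 true f -> {subset pvars f <= xs} ->
  decideA (code_kripke K) (code xs) (code_pformula f) <->
  models K (prefixed Exists xs ModA f).
Proof.
move=> cf fxs; rewrite /decideA code_eq0 nforall_trajE models_Exists.
have [->|xs0] := eqVneq xs [::].
  split=> // _; exists (fun=> fun=> set0) => //; apply/sat_ModA => t [v _].
  by have [[x tx] /(_ x tx)] := v 0.
have := decideEP K xs (forall_traj xs f); rewrite /decideE models_Exists => ->.
split=> -[sigma sg_tr st]; exists sigma => //.
  by apply/sat_ModA/(forall_trajP sigma cf fxs xs0)/(sat_ModE K).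
by apply/sat_ModE/(forall_trajP sigma cf fxs xs0)/(sat_ModA K).
Qed.

End Prefix.

Theorem theorem3 (AP : finType) (Q : quantifier) (M : modality)
    (C : formula_class) :
  decidable_problem (@code_instance AP) (@mc_instance AP Q M C)
    (fun i : kripke AP * formula AP => models i.1 i.2).
Proof.
exists (fun v => decide Q M (head 0 v)).
  exact: rec_decide Q M 1.
move=> [K phi] [xs [f [_ fxs /in_class_phase cf]]] /= ->.
have iE j : fld (head 0 [tuple code_instance (K, prefixed Q xs M f)]) j =
    nth 0 [:: code_kripke K; code_formula (prefixed Q xs M f)] j by apply: fld_code.
have b1 (b : bool) : b <-> nat_of_bool b = 1 by case: b.
(* A [Forall] prefix is decided through the negated body, which has to remain in the relaxed
   class. *)
have nf : bool_comb (@phase_or_co AP) 1 true (PNot f).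
  by apply: BC_not; apply: flip_polarity.
rewrite -b1; case: Q M iE => [] [] iE; rewrite /decide !iE [nth _ _ 0]/= [nth _ _ 1]/= nvarsE nbodyE.
- apply: iff_trans (sat_prefixed_Forall _ _ _ _ _) _.
  apply: iff_trans (not_iff_compat (iff_sym (decideAP K nf fxs))) _.
  by split=> /negP.
- apply: iff_trans (sat_prefixed_Forall _ _ _ _ _) _.
  apply: iff_trans (not_iff_compat (iff_sym (decideEP K xs (PNot f)))) _.
  by split=> /negP.
- exact: iff_sym (decideEP K xs f).
- exact: iff_sym (decideAP K cf fxs).
Qed.
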